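(* The property of being $R_\infty$ is undecidable amongst finitely presented groups. That is, there is no algorithm which takes as input an arbitrary finite group presentation $\langle X \mid R\rangle$ and decides whether or not the group it defines has property $R_\infty$.
   Context: Twisted conjugacy: for a group $G$ and $\varphi\in\mathrm{Aut}(G)$ (acting on the right), write $x\sim_\varphi y$ if there is $w\in G$ with $(w\varphi)\,x\,w^{-1}=y$; this is an equivalence relation on $G$. $G$ has property $R_\infty(\varphi)$ if $\sim_\varphi$ has infinitely many equivalence classes, and $G$ has property $R_\infty$ if it has $R_\infty(\varphi)$ for every $\varphi\in\mathrm{Aut}(G)$. *)

(* Defs.v *)
From HB Require Import structures.
From mathcomp Require Import all_boot.
From mathcomp Require Import boolp classical_sets cardinality.

Set Implicit Arguments.
Unset Strict Implicit.
Unset Printing Implicit Defensive.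

Local Open Scope classical_set_scope.
Local Open Scope quotient_scope.
Local Open Scope group_scope.

Definition twisted_conj (G : groupType) (phi : G -> G) (x y : G) : Prop :=
  exists w : G, phi w * x * w^-1 = y.

Definition twisted_classes (G : groupType) (phi : G -> G) : set (set G) :=
  [set [set y | twisted_conj phi x y] | x in [set: G]].

Definition R_infty_at (G : groupType) (phi : G -> G) : Prop :=
  infinite_set (twisted_classes phi).

Definition automorphism (G : groupType) (phi : G -> G) : Prop :=
  bijective phi /\ {morph phi : x y / x * y}.

Definition R_infty (G : groupType) : Prop :=
  forall phi : G -> G, automorphism phi -> R_infty_at phi.

(** The generating set is [{x_0, ..., x_(n-1)}]; the letter [(i, false)] stands
    for [x_i] and [(i, true)] for its inverse. *)
Definition word (n : nat) := seq ('I_n * bool).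

Record presentation := Presentation {
  ngens : nat;
  relators : seq (word ngens)
}.

Definition inv_letter n (a : 'I_n * bool) : 'I_n * bool := (a.1, ~~ a.2).

Definition inv_word n (w : word n) : word n := rev (map (@inv_letter n) w).

Inductive word_eq (P : presentation) :
    word (ngens P) -> word (ngens P) -> Prop :=
| word_eq_refl u : word_eq u u
| word_eq_sym u v : word_eq u v -> word_eq v u
| word_eq_trans u v w : word_eq u v -> word_eq v w -> word_eq u w
| word_eq_cat u u' v v' :
    word_eq u u' -> word_eq v v' -> word_eq (u ++ v) (u' ++ v')
| word_eq_cancel a : word_eq [:: a; inv_letter a] [::]
| word_eq_relator r : r \in relators P -> word_eq r [::].

Section PresentedGroup.
Variable P : presentation.
Local Notation W := (word (ngens P)).

Definition word_eqb : rel W := fun u v => `[< word_eq u v >].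

Fact word_eqb_refl : reflexive word_eqb.
Proof. by move=> u; apply/asboolP; exact: word_eq_refl. Qed.

Fact word_eqb_sym : symmetric word_eqb.
Proof. by move=> u v; apply/asboolP/asboolP; exact: word_eq_sym. Qed.

Fact word_eqb_trans : transitive word_eqb.
Proof.
by move=> v u w /asboolP uv /asboolP vw; apply/asboolP; exact: word_eq_trans vw.
Qed.

Canonical word_equiv :=
  EquivRel word_eqb word_eqb_refl word_eqb_sym word_eqb_trans.

Definition presented_group := {eq_quot word_equiv}.

HB.instance Definition _ := Choice.on presented_group.
HB.instance Definition _ := EqQuotient.on presented_group.

Definition word_class (w : W) : presented_group := \pi_presented_group w.

Definition presented_mul (x y : presented_group) : presented_group :=
  word_class (repr x ++ repr y).
Definition presented_one : presented_group := word_class [::].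
Definition presented_inv (x : presented_group) : presented_group :=
  word_class (inv_word (repr x)).

Lemma word_classP (u v : W) : word_class u = word_class v <-> word_eq u v.
Proof.
rewrite /word_class; split=> [/eqquotP /asboolP //|uv].
by apply/eqquotP/asboolP.
Qed.

Lemma repr_word_class (w : W) : word_eq (repr (word_class w)) w.
Proof. by apply/word_classP; rewrite /word_class reprK. Qed.

Lemma word_class_ind (T : presented_group -> Prop) :
  (forall w, T (word_class w)) -> forall x, T x.
Proof. by move=> Tw x; rewrite -[x]reprK; exact: Tw. Qed.

Lemma inv_letterK : involutive (@inv_letter (ngens P)).
Proof. by move=> [i b]; rewrite /inv_letter /= negbK. Qed.

Lemma inv_wordK : involutive (@inv_word (ngens P)).
Proof.
move=> w; rewrite /inv_word map_rev revK -map_comp map_id_in // => a _ /=.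
by rewrite inv_letterK.
Qed.

Lemma word_eq_mulV (w : W) : word_eq (w ++ inv_word w) [::].
Proof.
elim: w => [|a w IHw]; first exact: word_eq_refl.
have -> : (a :: w) ++ inv_word (a :: w) =
          [:: a] ++ ((w ++ inv_word w) ++ [:: inv_letter a]).
  by rewrite /inv_word /= rev_cons -cats1 -catA.
apply: word_eq_trans (word_eq_cancel a).
rewrite -[[:: a; inv_letter a]]/([:: a] ++ ([::] ++ [:: inv_letter a])).
apply: word_eq_cat; first exact: word_eq_refl.
by apply: word_eq_cat IHw _; exact: word_eq_refl.
Qed.

Lemma word_eq_Vmul (w : W) : word_eq (inv_word w ++ w) [::].
Proof. by have := word_eq_mulV (inv_word w); rewrite inv_wordK. Qed.

Lemma word_class_cat (u v : W) :
  word_class (u ++ v) = presented_mul (word_class u) (word_class v).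
Proof.
by apply/word_classP/word_eq_sym/word_eq_cat; exact: repr_word_class.
Qed.

Lemma presented_mulA : associative presented_mul.
Proof.
elim/word_class_ind=> u; elim/word_class_ind=> v; elim/word_class_ind=> w.
by rewrite -!word_class_cat catA.
Qed.

Lemma presented_mul1 : left_id presented_one presented_mul.
Proof. by elim/word_class_ind=> u; rewrite -word_class_cat. Qed.

Lemma presented_mulr1 : right_id presented_one presented_mul.
Proof. by elim/word_class_ind=> u; rewrite -word_class_cat cats0. Qed.

Lemma presented_mulV : left_inverse presented_one presented_inv presented_mul.
Proof.
move=> x; rewrite -{2}[x]reprK -[\pi _]/(word_class _) -word_class_cat.
by apply/word_classP; exact: word_eq_Vmul.
Qed.

Lemma presented_mulrV : right_inverse presented_one presented_inv presented_mul.
Proof.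
move=> x; rewrite -{1}[x]reprK -[\pi _]/(word_class _) -word_class_cat.
by apply/word_classP; exact: word_eq_mulV.
Qed.

HB.instance Definition _ := isGroup.Build presented_group presented_mulA
  presented_mul1 presented_mulr1 presented_mulV presented_mulrV.

End PresentedGroup.

Definition encode_letter n (a : 'I_n * bool) : nat := a.2 + (a.1 : nat).*2.

Definition encode_word n (w : word n) : nat :=
  CodeSeq.code (map (@encode_letter n) w).

Definition encode_presentation (P : presentation) : nat :=
  CodeSeq.code (ngens P :: map (@encode_word (ngens P)) (relators P)).

Lemma encode_letter_inj n : injective (@encode_letter n).
Proof.
move=> [i b] [j c]; rewrite /encode_letter /= => eq_ij.
have eq_bc : b = c.
  by have := congr1 odd eq_ij; rewrite !oddD !odd_double !addbF !oddb.
by have := congr1 half eq_ij; rewrite !half_bit_double eq_bc => /val_inj ->.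
Qed.

Lemma encode_presentation_inj : injective encode_presentation.
Proof.
move=> [n r] [m s] /(can_inj CodeSeq.codeK) /= [eq_nm].
case: m / eq_nm s => s /(inj_map _) -> //.
by move=> u v /(can_inj CodeSeq.codeK) /(inj_map (@encode_letter_inj n)).
Qed.

(** [rec_fun n] is the type of descriptions of partial [n]-ary functions. *)
Inductive rec_fun : nat -> Type :=
| RecZero : rec_fun 0
| RecSucc : rec_fun 1
| RecProj n (i : 'I_n) : rec_fun n
| RecComp n m (f : rec_fun m) (g : 'I_m -> rec_fun n) : rec_fun n
| RecPrim n (f : rec_fun n) (g : rec_fun n.+2) : rec_fun n.+1
| RecMin n (f : rec_fun n.+1) : rec_fun n.

(** [rec_eval f v y] means that [f] is defined at [v], with value [y].
    [RecPrim f g] is the function [h] with [h (0, v) = f v] and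
    [h (k.+1, v) = g (k, h (k, v), v)]; [RecMin f] maps [v] to the least [y]
    with [f (y, v) = 0], provided [f (z, v)] is defined for all [z < y]. *)
Fixpoint rec_eval n (f : rec_fun n) : n.-tuple nat -> nat -> Prop :=
  match f in rec_fun n return n.-tuple nat -> nat -> Prop with
  | RecZero => fun _ y => y = 0
  | RecSucc => fun v y => y = (thead v).+1
  | RecProj _ i => fun v y => y = tnth v i
  | RecComp _ m f g => fun v y =>
      exists2 w : m.-tuple nat,
        forall i, rec_eval (g i) v (tnth w i) & rec_eval f w y
  | RecPrim _ f g => fun v =>
      (fix iter k y :=
         if k is k'.+1 then
           exists2 z, iter k' z
                    & rec_eval g [tuple of k' :: z :: behead_tuple v] y
         else rec_eval f (behead_tuple v) y) (thead v)
  | RecMin _ f => fun v y =>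
      rec_eval f [tuple of y :: v] 0
      /\ forall z, z < y -> exists k, rec_eval f [tuple of z :: v] k.+1
  end.

Lemma rec_eval_fun n (f : rec_fun n) v y z :
  rec_eval f v y -> rec_eval f v z -> y = z.
Proof.
elim: f v y z => {n} [||n i|n m f IHf g IHg|n f IHf g IHg|n f IHf] v y z /=.
- by move=> -> ->.
- by move=> -> ->.
- by move=> -> ->.
- move=> [w gw fw] [w' gw' fw'].
  have eq_w : w = w' by apply: eq_from_tnth => i; exact: IHg (gw i) (gw' i).
  by move: fw'; rewrite -eq_w; exact: IHf.
- elim: (thead v) y z => [|k IHk] y z; first exact: IHf.
  by move=> [a ka ga] [b kb]; rewrite -(IHk _ _ ka kb); exact: IHg.
- move=> [fy lt_y] [fz lt_z]; case: (ltngtP y z) => // [/lt_z|/lt_y] [k fk].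
    by have := IHf _ _ _ fy fk.
  by have := IHf _ _ _ fz fk.
Qed.

Definition algorithmically_decidable (T : Type) (code : T -> nat)
    (A : T -> Prop) : Prop :=
  exists f : rec_fun 1, forall x : T,
    (A x -> rec_eval f [tuple code x] 1) /\
    (~ A x -> rec_eval f [tuple code x] 0).

(* Main.v *)
Require Import Defs.
From HB Require Import structures.
From mathcomp Require Import all_boot.
From mathcomp Require Import boolp classical_sets cardinality.
From mathcomp Require Import ssralg ssrnum ssrint order rat zify.

(** Given a decision procedure [f], let [g] be a partial recursive function that
    halts at [(k, m)] iff [f] answers 1 on [diagonal_code k m]. Compile [g] into a
    finite set of rules [(q, a + u M) -> (q', b + u N)] acting on states paired
    with natural numbers. From these rules and an input [n] one writes down a
    finitely presented group [G] such that
    - if the machine accepts [n], then [G] is infinite cyclic, generated by [t],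
      and inversion has only two twisted conjugacy classes;
    - otherwise [G] has property R_infty.
    The number [diagonal_code k m] is the code of the presentation when [k] is the
    number of its generators, [m] is the code of the relators other than the one
    encoding the input, and the input is [pr 0 ^ k * pr 1 ^ m]. For this presentation the answer of [f] is wrong.

    The configuration [(q, n)] is encoded by the involution
    [c := x ^ n * UT q * x ^ - n]. A generator for each rule conjugates the source
    configurations to the target ones, and [UK] commutes with these generators
    and with the halting configuration; hence it commutes with every accepting
    configuration. For a non-accepting [c] an action of the group on a set shows
    that [UK] and [c] do not commute. All generators [u] are involutions, and
    gluing copies of the symmetric group of degree 4 along pairs of commuting
    involutions makes the vanishing of the commutator of [UK] and the start
    configuration kill an involution [B], and the vanishing of [B] kill every [u].

    Finally, add [d] and [t] with [B d B = d ^ -1], [t d t ^ -1 = d ^ 2], and [t]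
    commuting with everything else. Let [A] be generated by everything but [t].
    All homomorphisms from [G] to the integers are multiples of the one, [chi],
    that kills [A] and sends [t] to 1. If [B] is nontrivial then
    [t A t ^ -1] is a proper subgroup of [A], so [G] is a strictly ascending HNN
    extension of a finitely generated group and no automorphism reverses [chi].
    So every automorphism preserves [chi], which is therefore constant on twisted
    conjugacy classes. *)

Set Implicit Arguments.
Unset Strict Implicit.
Unset Printing Implicit Defensive.

(** * Register programs computing recursive functions *)

(** A loop does its own test and decrement, so that every single instruction later becomes
    multiplication by one prime or exact division by one. *)
Inductive prog :=
| PSkip
| PInc of nat
| PSeq of prog & prog
| PLoop of nat & prog.

Definition store := nat -> nat.

Definition upd (v : store) i x : store := fun j => if j == i then x else v j.

Inductive exec : prog -> store -> store -> Prop :=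
| exec_PSkip v : exec PSkip v v
| exec_PInc i v : exec (PInc i) v (upd v i (v i).+1)
| exec_PSeq p q u v w : exec p u v -> exec q v w -> exec (PSeq p q) u w
| exec_PLoop0 i p v : v i = 0 -> exec (PLoop i p) v v
| exec_PLoopS i p n u v w : u i = n.+1 -> exec p (upd u i n) v ->
    exec (PLoop i p) v w -> exec (PLoop i p) u w.

Lemma exec_skipP v v' : exec PSkip v v' <-> v' = v.
Proof.
by split=> [H|->]; [inversion H | constructor].
Qed.

Lemma exec_incP i v v' : exec (PInc i) v v' <-> v' = upd v i (v i).+1.
Proof. by split=> [H|->]; [inversion H | constructor]. Qed.

Lemma exec_seqP p q v v' :
  exec (PSeq p q) v v' <-> exists2 u, exec p v u & exec q u v'.
Proof.
split=> [H|[u pu qu]]; last exact: exec_PSeq pu qu.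
by inversion H; subst; exists v0.
Qed.

Lemma exec_loop0P i p v v' : v i = 0 -> exec (PLoop i p) v v' <-> v' = v.
Proof.
move=> vi; split=> [H|->]; last exact: exec_PLoop0.
by inversion H; subst=> //; congruence.
Qed.

Lemma exec_loopSP i p n v v' : v i = n.+1 ->
  exec (PLoop i p) v v' <->
  exists2 u, exec p (upd v i n) u & exec (PLoop i p) u v'.
Proof.
move=> vi; split=> [H|[u pu qu]]; last exact: exec_PLoopS vi pu qu.
inversion H as [| | |i' p' u vi0|i' p' n' u w w' vi' pu qu]; subst.
  by congruence.
by exists w => //; move: vi'; rewrite vi => -[->].
Qed.

Ltac upd_ext :=
  apply/funext => ?; rewrite /upd;
  repeat (let e := fresh in case: eqP => e; [rewrite ?e|]); (congruence || lia).

Definition pclear i := PLoop i PSkip.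

Lemma exec_clear i v v' : exec (pclear i) v v' <-> v' = upd v i 0.
Proof.
rewrite /pclear; move def_n: (v i) => n.
elim: n v v' def_n => [|n IHn] v v' vi.
  rewrite exec_loop0P //; suff -> : upd v i 0 = v by [].
  by upd_ext.
rewrite (exec_loopSP _ _ vi); have eqv : upd (upd v i n) i 0 = upd v i 0 by upd_ext.
have vi' : upd v i n i = n by rewrite /upd eqxx.
split=> [[u /exec_skipP -> /(IHn _ _ vi')]|->]; first by rewrite eqv.
by exists (upd v i n); [exact/exec_skipP | apply/(IHn _ _ vi')].
Qed.

Definition pmove i j := PLoop i (PInc j).

Lemma exec_move i j v v' : i <> j ->
  exec (pmove i j) v v' <-> v' = upd (upd v j (v j + v i)) i 0.
Proof.
move=> ij; rewrite /pmove; move def_n: (v i) => n.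
elim: n v v' def_n => [|n IHn] v v' vi.
  rewrite exec_loop0P //; suff -> : upd (upd v j (v j + 0)) i 0 = v by [].
  by upd_ext.
rewrite (exec_loopSP _ _ vi).
set u := upd (upd v i n) j (upd v i n j).+1.
have ui : u i = n by rewrite /u /upd eqxx; case: eqP.
have eqv : upd (upd u j (u j + n)) i 0 = upd (upd v j (v j + n.+1)) i 0.
  by rewrite /u; upd_ext.
split=> [[u' /exec_incP -> /(IHn _ _ ui)]|->]; first by rewrite eqv.
by exists u; [exact/exec_incP | apply/(IHn _ _ ui)].
Qed.

(** The loop drains [i] into both [j] and the scratch register [t], from which [i] is then
    restored. *)
Definition pcopy i j t := PSeq (PLoop i (PSeq (PInc j) (PInc t))) (pmove t i).

Lemma exec_copy i j t v v' : i <> j -> i <> t -> j <> t ->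
  v j = 0 -> v t = 0 -> exec (pcopy i j t) v v' <-> v' = upd v j (v i).
Proof.
move=> ij it jt vj vt.
have spread u u' : exec (PLoop i (PSeq (PInc j) (PInc t))) u u' <->
    u' = upd (upd (upd u j (u j + u i)) t (u t + u i)) i 0.
  move def_n: (u i) => n; elim: n u u' def_n => [|n IHn] u u' ui.
    rewrite exec_loop0P //; set w := upd _ _ _; suff -> : w = u by [].
    by rewrite /w; upd_ext.
  rewrite (exec_loopSP _ _ ui).
  set w := upd (upd (upd u i n) j (u j).+1) t (u t).+1.
  have wi : w i = n by rewrite /w /upd eqxx; do ?case: eqP.
  have eqv : upd (upd (upd w j (w j + n)) t (w t + n)) i 0 =
             upd (upd (upd u j (u j + n.+1)) t (u t + n.+1)) i 0.
    by rewrite /w; upd_ext.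
  have pw u1 : exec (PSeq (PInc j) (PInc t)) (upd u i n) u1 <-> u1 = w.
    rewrite exec_seqP; split=> [[u2 /exec_incP -> /exec_incP ->]|->].
      by rewrite /w; upd_ext.
    eexists; first exact/exec_incP.
    by apply/exec_incP; rewrite /w; upd_ext.
  split=> [[u1 /pw -> /(IHn _ _ wi)]|->]; first by rewrite eqv.
  by exists w; [exact/pw | apply/(IHn _ _ wi)].
rewrite exec_seqP; split.
  by move=> [u /spread -> /exec_move ->]; [upd_ext | congruence].
move=> ->; eexists; first exact/spread.
by apply/exec_move; [congruence | upd_ext].
Qed.

Definition pseq := foldr PSeq PSkip.

(** Registers from [b] on are scratch space. In [RecPrim], [b] counts the remaining rounds, [b.+2]
    the completed ones, and [out] holds the current value; in [RecMin], [out] is the candidate and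
    [b] the value of [f] there. *)
Fixpoint compile n (f : rec_fun n) : n.-tuple nat -> nat -> nat -> prog :=
  match f in rec_fun n return n.-tuple nat -> nat -> nat -> prog with
  | RecZero => fun _ _ _ => PSkip
  | RecSucc => fun ins out b => PSeq (pcopy (thead ins) out b) (PInc out)
  | RecProj _ i => fun ins out b => pcopy (tnth ins i) out b
  | RecComp _ m f g => fun ins out b =>
      PSeq (pseq [seq compile (g i) ins (b + i) (b + m) | i <- enum 'I_m])
        (PSeq (compile f [tuple b + i | i < m] out (b + m))
              (pseq [seq pclear (b + i) | i <- iota 0 m]))
  | RecPrim _ f g => fun ins out b =>
      let: body := PSeq (compile g [tuple of [:: b.+2, out & behead_tuple ins]] b.+1 b.+3)
                 (PSeq (pclear out) (PSeq (pmove b.+1 out) (PInc b.+2))) in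
      PSeq (pcopy (thead ins) b b.+1)
        (PSeq (compile f (behead_tuple ins) out b.+3)
          (PSeq (PLoop b body) (pclear b.+2)))
  | RecMin _ f => fun ins out b =>
      let: eval := compile f [tuple of out :: ins] b b.+1 in
      PSeq eval (PLoop b (PSeq (pclear b) (PSeq (PInc out) eval)))
  end.

Definition read n (v : store) (ins : n.-tuple nat) := map_tuple v ins.

Lemma eq_read n v v' (ins : n.-tuple nat) :
  {in ins, v =1 v'} -> read v ins = read v' ins.
Proof. by move=> eqv; apply: val_inj; apply/eq_in_map. Qed.

Lemma read_upd n v i x (ins : n.-tuple nat) :
  i \notin ins -> read (upd v i x) ins = read v ins.
Proof.
move=> i_ins; apply: eq_read => j j_ins; rewrite /upd; case: eqP => // ji.
by rewrite -ji j_ins in i_ins.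
Qed.

(** The equivalence also covers divergence. Since the final store differs from [v] only at [out],
    inputs survive and scratch registers are zero again, which lets compiled pieces be chained. *)
Definition compile_ok n (f : rec_fun n) := forall ins out b v v',
  {in ins, forall i, i < b} -> out < b -> out \notin ins ->
  v out = 0 -> (forall r, b <= r -> v r = 0) ->
  exec (compile f ins out b) v v' <->
  exists2 y, rec_eval f (read v ins) y & v' = upd v out y.

Lemma compile_zero_ok : compile_ok RecZero.
Proof.
move=> ins out b v v' _ _ _ v_out _ /=; rewrite exec_skipP.
have eqv : upd v out 0 = v by upd_ext.
by split=> [->|[y -> ->]]; [exists 0|].
Qed.

Lemma compile_proj_ok n (i : 'I_n) : compile_ok (RecProj i).
Proof.
move=> ins out b v v' ins_b out_b ins_out v_out v_b /=.
have in_i := mem_tnth i ins; have lt_b := ins_b _ in_i.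
have i_out : tnth ins i <> out by move=> e; rewrite -e in_i in ins_out.
have copyP : exec (pcopy (tnth ins i) out b) v v' <-> v' = upd v out (v (tnth ins i)).
  by apply: exec_copy => //; [lia|lia|exact: v_b].
by rewrite copyP /read tnth_map; split=> [->|[y -> ->]]; [exists (v (tnth ins i))|].
Qed.

Lemma compile_succ_ok : compile_ok RecSucc.
Proof.
move=> ins out b v v' ins_b out_b ins_out v_out v_b /=.
have in_i : thead ins \in ins by rewrite /thead mem_tnth.
have lt_b := ins_b _ in_i.
have i_out : thead ins <> out by move=> e; rewrite -e in_i in ins_out.
rewrite exec_seqP /read /thead tnth_map -/(thead ins).
have copyP u : exec (pcopy (thead ins) out b) v u <-> u = upd v out (v (thead ins)).
  by apply: exec_copy => //; [lia|lia|exact: v_b].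
have eqv : upd (upd v out (v (thead ins))) out (upd v out (v (thead ins)) out).+1
  = upd v out (v (thead ins)).+1 by upd_ext.
split=> [[u /copyP -> /exec_incP ->]|[y -> ->]]; first by eexists.
by eexists; [exact/copyP | apply/exec_incP].
Qed.

Lemma compile_min_ok n (f : rec_fun n.+1) :
  compile_ok f -> compile_ok (RecMin f).
Proof.
move=> f_ok ins out b v0 v' ins_b out_b ins_out v_out v_b /=.
set ev := compile _ _ _ _.
have evP y u : exec ev (upd v0 out y) u <->
    exists2 x, rec_eval f [tuple of y :: read v0 ins] x &
               u = upd (upd v0 out y) b x.
  have -> : [tuple of y :: read v0 ins] = read (upd v0 out y) [tuple of out :: ins].
    apply: val_inj; rewrite /= {1}/upd eqxx; congr (_ :: _).
    by have /(congr1 val) := read_upd v0 y ins_out; rewrite /= => ->.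
  apply: f_ok => //.
  - by move=> i; rewrite inE => /predU1P[->|/ins_b]; lia.
  - by rewrite inE negb_or; apply/andP; split; [lia | apply/negP => /ins_b; lia].
  - by rewrite /upd; case: eqP => [|_]; [lia | apply: v_b].
  - by move=> r r_b; rewrite /upd; case: eqP => [|_]; [lia | apply: v_b; lia].
have v0E : v0 = upd v0 out 0 by upd_ext.
set body := PSeq (pclear b) _.
have bodyP y x u : exec body (upd (upd v0 out y) b x) u <->
    exec ev (upd v0 out y.+1) u.
  have incE (w := upd (upd (upd v0 out y) b x) b 0) :
      upd w out (w out).+1 = upd v0 out y.+1.
    have vb := v_b b (leqnn b); have ? : b <> out by lia.
    by rewrite /w; upd_ext.
  rewrite exec_seqP; split.
    by move=> [u1 /exec_clear ->] /exec_seqP[u2 /exec_incP ->]; rewrite incE.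
  move=> evu; eexists; first exact/exec_clear.
  apply/exec_seqP; eexists; first exact/exec_incP.
  by rewrite incE.
have updb y x x' : upd (upd (upd v0 out y) b x) b x' = upd (upd v0 out y) b x' by upd_ext.
have updb0 y : upd (upd v0 out y) b 0 = upd v0 out y.
  have vb := v_b b (leqnn b); have ? : b <> out by lia.
  by upd_ext.
rewrite exec_seqP; split.
  rewrite {1}v0E => -[u /evP[x f0x ->]] loop.
  (* Termination is given, so the induction is on the execution of the loop; the store is
     generalised to any candidate [y] below which [f] has no zero. *)
  suff gen p u1 u2 : exec p u1 u2 -> forall y x,
      rec_eval f [tuple of y :: read v0 ins] x ->
      (forall z, z < y -> exists k, rec_eval f [tuple of z :: read v0 ins] k.+1) ->
      upd (upd v0 out y) b x = u1 -> PLoop b body = p ->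
      exists2 y', rec_eval (RecMin f) (read v0 ins) y' & u2 = upd v0 out y'.
    exact: gen loop _ _ f0x _ erefl erefl.
  move=> {u x f0x loop}; elim=> {p u1 u2} //.
  - move=> i p u ui0 y x fyx miny def_u [eqi _]; move: ui0.
    rewrite -{}eqi -def_u {1}/upd eqxx => x0; exists y; last by rewrite x0 updb0.
    by rewrite x0 in fyx.
  - move=> i p k u1 u2 u3 u1i pu _ _ IH y x fyx miny def_u eqp.
    move: u1i pu; have [<- <-] := eqp; rewrite -def_u updb {1}/upd eqxx => xk.
    move/bodyP/evP => [x' fx' u2E].
    apply: (IH y.+1 x') => //.
    move=> z; rewrite ltnS leq_eqVlt => /predU1P[->|/miny //].
    by exists k; rewrite -xk.
move=> [y [fy miny] ->].
(* Conversely, the loop reaches the minimum [y] from any candidate [z], by induction on the distance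
   [y - z]. *)
have loopP z x : z <= y -> rec_eval f [tuple of z :: read v0 ins] x ->
    exec (PLoop b body) (upd (upd v0 out z) b x) (upd v0 out y).
  move def_d: (y - z) => d; elim: d z x def_d => [|d IHd] z x zd zy fz.
    have zy' : z = y by lia.
    rewrite zy' in fz *; rewrite (rec_eval_fun fz fy) updb0.
    by apply: exec_PLoop0; rewrite /upd; case: eqP => [|_]; [lia | apply: v_b].
  have zy' : z < y by lia.
  have [k fzk] := miny _ zy'; rewrite (rec_eval_fun fz fzk).
  have [x' fx'] : exists x', rec_eval f [tuple of z.+1 :: read v0 ins] x'.
    have [/miny[k' ?]|] := ltnP z.+1 y; first by exists k'.+1.
    by move=> yz; exists 0; rewrite (_ : z.+1 = y) //; lia.
  apply: (exec_PLoopS (n := k) (v := upd (upd v0 out z.+1) b x')); first by rewrite /upd eqxx.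
    by rewrite updb; apply/bodyP/evP; exists x'.
  by apply: IHd => //; lia.
have [x fx] : exists x, rec_eval f [tuple of 0 :: read v0 ins] x.
  case: (posnP y) fy miny => [->|y0] fy miny; first by exists 0.
  by have [k ?] := miny _ y0; exists k.+1.
exists (upd (upd v0 out 0) b x); last exact: loopP.
by rewrite [X in exec _ X]v0E; apply/evP; exists x.
Qed.

(** The inner fixpoint of [rec_eval] for [RecPrim], abstracted from [f] and [g] so that loop
    invariants can mention it. *)
Fixpoint prim_rel (F : nat -> Prop) (S : nat -> nat -> nat -> Prop) k y :=
  if k is k'.+1 then exists2 z, prim_rel F S k' z & S k' z y else F y.

Lemma rec_eval_prim n (f : rec_fun n) (g : rec_fun n.+2) v :
  rec_eval (RecPrim f g) v =
  prim_rel (rec_eval f (behead_tuple v))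
    (fun k z => rec_eval g [tuple of k :: z :: behead_tuple v]) (thead v).
Proof.
apply/funext => y; rewrite /=; elim: (thead v) y => //= k IHk y.
by congr (ex2 _ _); apply/funext => z; exact: IHk.
Qed.

Lemma read_cons n (v : store) i (ins : n.-tuple nat) :
  read v [tuple of i :: ins] = [tuple of v i :: read v ins].
Proof. by apply: val_inj. Qed.

Lemma read_behead n (v : store) (ins : n.+1.-tuple nat) :
  read v (behead_tuple ins) = behead_tuple (read v ins).
Proof. by apply: val_inj; case: ins => -[]. Qed.

Lemma thead_read n (v : store) (ins : n.+1.-tuple nat) :
  thead (read v ins) = v (thead ins).
Proof. by rewrite /thead tnth_map. Qed.

Lemma compile_prim_ok n (f : rec_fun n) (g : rec_fun n.+2) :
  compile_ok f -> compile_ok g -> compile_ok (RecPrim f g).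
Proof.
move=> f_ok g_ok ins out b v0 v' ins_b out_b ins_out v_out v_b.
rewrite rec_eval_prim -read_behead thead_read /=.
set x0 := thead ins; set tl := behead_tuple ins.
have in_x0 : x0 \in ins by rewrite mem_tnth.
have x0_b := ins_b _ in_x0.
have x0_out : x0 <> out by move=> e; rewrite -e in_x0 in ins_out.
have tl_ins : {subset tl <= ins} by move=> i /mem_behead.
have tl_b i : i \in tl -> i < b by move/tl_ins/ins_b.
have out_tl : out \notin tl by apply/negP => /tl_ins; apply/negP.
have vb : v0 b = 0 by apply: v_b.
have vb1 : v0 b.+1 = 0 by apply: v_b.
have vb2 : v0 b.+2 = 0 by apply: v_b; lia.
set F := rec_eval f _; set G := fun k z => rec_eval g _.
(* The stores met at the head of the loop: [k] rounds remain, [i] are done, and [y] is the current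
   value. *)
pose st k i y : store := upd (upd (upd v0 b k) b.+2 i) out y.
have st_tl k i y : read (st k i y) tl = read v0 tl.
  by rewrite !read_upd //; apply/negP => /tl_b; lia.
have st_b k i y r : b.+3 <= r -> st k i y r = 0.
  by move=> br; rewrite /st /upd !ifF ?v_b //; lia.
set body := (X in PLoop b X).
have bodyP k i y u : exec body (st k i y) u <->
    exists2 z, G i y z & u = st k i.+1 z.
  rewrite /body; set ev := compile g _ _ _.
  have evP w : exec ev (st k i y) w <->
      exists2 z, G i y z & w = upd (st k i y) b.+1 z.
    have -> : G i y = rec_eval g (read (st k i y) [tuple of [:: b.+2, out & tl]]).
      rewrite (read_cons _ b.+2 [tuple of out :: tl]) read_cons st_tl /G.
      congr (rec_eval g _); apply: val_inj => /=; rewrite {2}/st /upd eqxx.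
      by rewrite /st /upd eqxx ifF //; lia.
    apply: g_ok => //.
    - move=> j; rewrite !inE => /or3P[/eqP->|/eqP->|/tl_b]; lia.
    - by rewrite !inE !negb_or; apply/and3P; split; try lia; apply/negP => /tl_b; lia.
    - by rewrite /st /upd !ifF //; lia.
    - by move=> r br; apply: st_b.
  have restP w z : exec (PSeq (pclear out) (PSeq (pmove b.+1 out) (PInc b.+2)))
      (upd (st k i y) b.+1 z) w <-> w = st k i.+1 z.
    have e w1 w2 : w1 = upd (upd (st k i y) b.+1 z) out 0 ->
        w2 = upd (upd w1 out (w1 out + w1 b.+1)) b.+1 0 ->
        upd w2 b.+2 (w2 b.+2).+1 = st k i.+1 z.
      by move=> -> ->; rewrite /st; upd_ext.
    have mv : b.+1 <> out by lia.
    rewrite exec_seqP; split.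
      move=> [w1 /exec_clear e1 /exec_seqP[w2 /(exec_move _ _ mv) e2 /exec_incP ->]].
      exact: e e2.
    move=> ->; eexists; first exact/exec_clear.
    apply/exec_seqP; eexists; first exact/(exec_move _ _ mv).
    by apply/exec_incP; rewrite (e _ _ erefl erefl).
  rewrite exec_seqP; split.
    by move=> [w /evP[z Gz ->] /restP ->]; exists z.
  by move=> [z Gz ->]; exists (upd (st k i y) b.+1 z); [apply/evP; exists z | apply/restP].
have st_body k k' i y : upd (st k i y) b k' = st k' i y.
  by rewrite /st; upd_ext.
have prim_fun i y z : prim_rel F G i y -> prim_rel F G i z -> y = z.
  elim: i y z => [|i IHi] y z /=; first exact: rec_eval_fun.
  by move=> [a ka ga] [a' ka']; rewrite -(IHi _ _ ka ka') => ga'; exact: rec_eval_fun ga'.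
have loopP k i y u : prim_rel F G i y ->
    exec (PLoop b body) (st k i y) u <->
    exists2 z, prim_rel F G (i + k) z & u = st 0 (i + k) z.
  have st_bk k' i' y' : st k' i' y' b = k'.
    by rewrite /st /upd eqxx !ifF //; lia.
  elim: k i y u => [|k IHk] i y u Fy.
    rewrite exec_loop0P // addn0; split=> [->|]; first by exists y.
    by move=> [z Fz ->]; rewrite (prim_fun _ _ _ Fy Fz).
  rewrite (exec_loopSP _ _ (st_bk _ _ _)) st_body; split.
    move=> [w /bodyP[z Gz ->] /IHk]; rewrite addSnnS.
    by apply; exists y.
  rewrite -addSnnS => -[z Fz ->].
  (* A value at stage [i.+1 + k] presupposes one at stage [i.+1], which is what the first round of
     the loop computes. *)
  have [a [Fa ka]] : exists a, prim_rel F G i.+1 a /\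
      exec (PLoop b body) (st k i.+1 a) (st 0 (i.+1 + k) z).
    suff [a Fa] : exists a, prim_rel F G i.+1 a.
      by exists a; split=> //; apply/IHk => //; exists z.
    elim: k z Fz {IHk} => [|k IHk] z; first by rewrite addn0; exists z.
    by rewrite addnS /= => -[z' Fz' _]; apply: IHk Fz'.
  exists (st k i.+1 a) => //; apply/bodyP; exists a => //.
  by case: Fa => y' Fy'; rewrite (prim_fun _ _ _ Fy Fy').
have copyP u : exec (pcopy x0 b b.+1) v0 u <-> u = st (v0 x0) 0 0.
  rewrite exec_copy //; try lia.
  by rewrite (_ : upd v0 b (v0 x0) = st (v0 x0) 0 0) // /st; upd_ext.
have initP k u : exec (compile f tl out b.+3) (st k 0 0) u <->
    exists2 y, F y & u = st k 0 y.
  rewrite f_ok //; first last.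
  - by move=> r br; apply: st_b.
  - by rewrite /st /upd eqxx.
  - by lia.
  - by move=> i /tl_b; lia.
  rewrite st_tl -/F; split=> -[y Fy ->]; exists y => //;
  by rewrite /st; upd_ext.
rewrite exec_seqP; split.
  move=> [u0 /copyP -> /exec_seqP[u1]] /initP[y Fy ->].
  move=> /exec_seqP[u /(loopP _ 0 y u Fy)[z Fz ->] /exec_clear ->].
  exists z; rewrite ?add0n //.
  by rewrite /st; upd_ext.
move=> [z Fz ->]; exists (st (v0 x0) 0 0); first exact/copyP.
have [y Fy] : exists y, prim_rel F G 0 y.
  elim: (v0 x0) z Fz => [|k IHk] z; first by exists z.
  by move=> [z' Fz' _]; apply: IHk Fz'.
apply/exec_seqP; exists (st (v0 x0) 0 y); first by apply/initP; exists y.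
apply/exec_seqP; exists (st 0 (v0 x0) z).
  by apply/(loopP _ 0 y _ Fy); exists z.
by apply/exec_clear; rewrite /st; upd_ext.
Qed.

(** Composition stores the values of its inner functions in the block of registers that begins at
    [b]; [w] is indexed relative to the start of the block. *)
Definition fill (v : store) (s : seq nat) b (w : nat -> nat) : store :=
  fun r => if r \in [seq b + i | i <- s] then w (r - b) else v r.

Lemma exec_clear_seq s b v v' :
  exec (pseq [seq pclear (b + i) | i <- s]) v v' <-> v' = fill v s b (fun=> 0).
Proof.
elim: s v v' => [|i s IHs] v v' /=; first exact: exec_skipP.
rewrite exec_seqP; have -> : fill v (i :: s) b (fun=> 0) =
    fill (upd v (b + i) 0) s b (fun=> 0).
  by apply/funext => r; rewrite /fill /upd /= inE; case: eqP => //= _; case: ifP.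
split=> [[u /exec_clear -> /IHs]//|->].
by eexists; [exact/exec_clear | exact/IHs].
Qed.

Lemma compile_comp_ok n m (f : rec_fun m) (g : 'I_m -> rec_fun n) :
  compile_ok f -> (forall i, compile_ok (g i)) -> compile_ok (RecComp f g).
Proof.
move=> f_ok g_ok ins out b v0 v' ins_b out_b ins_out v_out v_b /=.
have mem_shift (s : seq nat) i : (b + i \in [seq b + j | j <- s]) = (i \in s).
  by rewrite mem_map //; exact: addnI.
(* Stated for any store that agrees with [v0] on the inputs, because earlier results have already
   been written when the next inner function runs. *)
have argsP (s : seq 'I_m) v u : uniq s -> {in ins, v =1 v0} ->
    (forall i, i \in s -> v (b + i) = 0) -> (forall r, b + m <= r -> v r = 0) ->
    exec (pseq [seq compile (g i) ins (b + i) (b + m) | i <- s]) v u <->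
    exists2 w : nat -> nat, forall i, i \in s -> rec_eval (g i) (read v0 ins) (w i)
      & u = fill v (map val s) b w.
  elim: s v u => [|i s IHs] v u /=.
    by move=> _ _ _ _; rewrite exec_skipP; split=> [->|[w _ ->]//]; exists id.
  move=> /andP[i_s uniq_s] eqv v0s vbm.
  have iP u1 : exec (compile (g i) ins (b + i) (b + m)) v u1 <->
      exists2 y, rec_eval (g i) (read v0 ins) y & u1 = upd v (b + i) y.
    rewrite -(eq_read eqv); apply: g_ok => //.
    - by move=> j /ins_b; lia.
    - by have := ltn_ord i; lia.
    - by apply/negP => /ins_b; lia.
    - by rewrite v0s ?mem_head.
  have sP y u1 : exec (pseq [seq compile (g i0) ins (b + i0) (b + m) | i0 <- s])
      (upd v (b + i) y) u1 <->
      exists2 w : nat -> nat, forall j, j \in s -> rec_eval (g j) (read v0 ins) (w j)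
        & u1 = fill (upd v (b + i) y) (map val s) b w.
    apply: IHs => //.
    - by move=> j j_ins; rewrite -eqv // /upd ifF //; have := ins_b _ j_ins; lia.
    - move=> j j_s; rewrite /upd ifF ?v0s // ?inE ?j_s ?orbT //.
      by rewrite eqn_add2l; apply/eqP => /val_inj ji; rewrite -ji j_s in i_s.
    - by move=> r br; rewrite /upd ifF ?vbm //; have := ltn_ord i; lia.
  rewrite exec_seqP; split.
    move=> [_ /iP[y gy ->] /sP[w gw ->]].
    exists (upd w i y).
      move=> j; rewrite inE /upd => /predU1P[->|j_s]; first by rewrite eqxx.
      rewrite ifF; first exact: gw.
      by apply/eqP => /val_inj ji; rewrite -ji j_s in i_s.
    apply/funext => r; rewrite /fill /upd /= inE; case: eqP => [->|ri] /=.
      by rewrite addKn eqxx mem_shift mem_map ?(negbTE i_s) //; exact: val_inj.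
    case: ifP => // /mapP[j _ rj]; rewrite ifF //; lia.
  move=> [w gw ->]; exists (upd v (b + i) (w i)).
    by apply/iP; exists (w i) => //; apply: gw; rewrite mem_head.
  apply/sP; exists w; first by move=> j j_s; apply: gw; rewrite inE j_s orbT.
  apply/funext => r; rewrite /fill /upd /= inE; case: eqP => [->|ri] //=.
  by rewrite addKn; case: ifP.
set args := pseq _; have {}argsP u : exec args v0 u <->
    exists2 w : nat -> nat, forall i : 'I_m, rec_eval (g i) (read v0 ins) (w i)
      & u = fill v0 (iota 0 m) b w.
  rewrite /args argsP ?enum_uniq //; first last.
  - by move=> r br; apply: v_b; lia.
  - by move=> i _; apply: v_b; lia.
  rewrite val_enum_ord; split=> -[w gw ->]; exists w => // i; apply: gw.
  by rewrite mem_enum.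
set bs := [tuple _ | _ < _].
have readP w : read (fill v0 (iota 0 m) b w) bs = [tuple w i | i < m].
  apply: eq_from_tnth => i; rewrite !tnth_map tnth_ord_tuple /fill mem_shift.
  by rewrite mem_iota ltn_ord addKn.
have fP w u : exec (compile f bs out (b + m)) (fill v0 (iota 0 m) b w) u <->
    exists2 y, rec_eval f [tuple w i | i < m] y
      & u = upd (fill v0 (iota 0 m) b w) out y.
  rewrite -readP; apply: f_ok.
  - by move=> _ /mapP[i _ ->]; rewrite ltn_add2l.
  - by lia.
  - by apply/negP => /mapP[i _]; lia.
  - by rewrite /fill ifF //; apply/negP => /mapP[i _]; lia.
  - move=> r br; rewrite /fill ifF; first by apply: v_b; lia.
    by apply/negP => /mapP[i]; rewrite mem_iota; lia.
have finalE w y : fill (upd (fill v0 (iota 0 m) b w) out y) (iota 0 m) b (fun=> 0)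
    = upd v0 out y.
  apply/funext => r; rewrite /fill /upd; case: ifP => [/mapP[i]|-> //].
  by rewrite mem_iota => im ->; rewrite ifF ?v_b //; lia.
rewrite exec_seqP; split.
  move=> [_ /argsP[w gw ->] /exec_seqP[_ /fP[y fy ->] /exec_clear_seq ->]].
  exists y => //; exists [tuple w i | i < m] => // i.
  by rewrite tnth_mktuple.
move=> [y [w gw fw] ->].
have wE : w = [tuple nth 0 w i | i < m].
  by apply: eq_from_tnth => i; rewrite tnth_mktuple -tnth_nth.
exists (fill v0 (iota 0 m) b (nth 0 w)).
  by apply/argsP; exists (nth 0 w) => // i; rewrite -tnth_nth.
apply/exec_seqP; eexists; first by apply/fP; exists y; rewrite // -wE.
by apply/exec_clear_seq; rewrite finalE.
Qed.

Lemma compileP n (f : rec_fun n) : compile_ok f.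
Proof.
elim: f => {n} [||n i|n m f IHf g IHg|n f IHf g IHg|n f IHf].
- exact: compile_zero_ok.
- exact: compile_succ_ok.
- exact: compile_proj_ok.
- exact: compile_comp_ok.
- exact: compile_prim_ok.
- exact: compile_min_ok.
Qed.

(** Clearing the inputs and the output makes the final store zero, so that halting always occurs at
    the Goedel number 1. *)
Definition main_prog (f : rec_fun 2) :=
  PSeq (compile f [tuple 0; 1] 2 3) (pseq [seq pclear (0 + i) | i <- iota 0 3]).

Definition start_store (x y : nat) : store := nth 0 [:: x; y].

Lemma main_progP (f : rec_fun 2) x y v :
  exec (main_prog f) (start_store x y) v <->
  (exists z, rec_eval f [tuple x; y] z) /\ v = fun=> 0.
Proof.
have readE : read (start_store x y) [tuple 0; 1] = [tuple x; y] by apply: val_inj.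
have fP u : exec (compile f [tuple 0; 1] 2 3) (start_store x y) u <->
    exists2 z, rec_eval f [tuple x; y] z & u = upd (start_store x y) 2 z.
  rewrite -readE; apply: compileP => //.
  - by move=> i; rewrite !inE => /orP[]/eqP->.
  - by case=> [|[|[|]]].
have clearE z : fill (upd (start_store x y) 2 z) (iota 0 3) 0 (fun=> 0) = fun=> 0.
  by apply/funext => -[|[|[|r]]]; rewrite /fill /upd /start_store //= ?nth_nil.
rewrite exec_seqP; split.
  by move=> [_ /fP[z fz ->] /exec_clear_seq ->]; split; [exists z | exact: clearE].
move=> [[z fz] ->]; eexists; first by apply/fP; exists z.
by apply/exec_clear_seq; rewrite clearE.
Qed.

(** * From programs to affine rules on natural numbers *)

HB.instance Definition _ := gen_eqMixin prog.

Record rule (Q : Type) := Rule {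
  src : Q; ra : nat; rm : nat;
  dst : Q; rb : nat; rn : nat
}.

HB.instance Definition _ (Q : Type) := gen_eqMixin (rule Q).

Definition rstep (Q : Type) (nr : nat) (rs : 'I_nr -> rule Q) (c c' : Q * nat) :=
  exists i, exists2 u, c = (src (rs i), ra (rs i) + u * rm (rs i))
                     & c' = (dst (rs i), rb (rs i) + u * rn (rs i)).

Inductive accepts (Q : Type) (nr : nat) (rs : 'I_nr -> rule Q) (h : Q) :
    Q * nat -> Prop :=
| accepts_halt : accepts rs h (h, 1)
| accepts_step c c' : rstep rs c c' -> accepts rs h c' -> accepts rs h c.

(** The bounds force [u] to be nonnegative wherever a rule extended to the integers meets a natural
    number; distinct states make its two sides disjoint; the last two conditions carry acceptance
    forward along a rule. *)
Record machine_ok (Q : Type) (nr : nat) (rs : 'I_nr -> rule Q) (h : Q) : Prop := {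
  ra_lt : forall i, ra (rs i) < rm (rs i);
  rb_lt : forall i, rb (rs i) < rn (rs i);
  src_dst : forall i, src (rs i) <> dst (rs i);
  src_halt : forall i, src (rs i) <> h;
  rstep_det : forall c c1 c2, rstep rs c c1 -> rstep rs c c2 -> c1 = c2
}.

(** * Stack semantics of programs and its coding by natural numbers *)

Definition stack := seq prog.

Definition next_stack (k : stack) (v : store) : option (stack * store) :=
  match k with
  | [::] => None
  | PSkip :: k' => Some (k', v)
  | PInc i :: k' => Some (k', upd v i (v i).+1)
  | PSeq p q :: k' => Some ([:: p, q & k'], v)
  | PLoop i p :: k' =>
      if v i is n.+1 then Some (p :: k, upd v i n) else Some (k', v)
  end.

Inductive runs : stack -> store -> store -> Prop :=
| runs_nil v : runs [::] v v
| runs_step k v k1 v1 v' : next_stack k v = Some (k1, v1) -> runs k1 v1 v' ->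
    runs k v v'.

Lemma runsP k v v' : runs k v v' <-> exec (pseq k) v v'.
Proof.
split.
  elim=> {k v v'} [v|k v k1 v1 v' + _]; first exact: exec_PSkip.
  case: k => [//|p k] /=; rewrite exec_seqP; case: p => [|i|p q|i p] /=.
  - by move=> -[<- <-] kv'; exists v => //; exact: exec_PSkip.
  - by move=> -[<- <-] kv'; eexists; [exact: exec_PInc | exact: kv'].
  - move=> -[<- <-] /= /exec_seqP[u pu /exec_seqP[w qw kw]].
    by exists w => //; exact: exec_PSeq pu qw.
  - case vi: (v i) => [|n] -[<- <-] /=.
      by move=> kv'; exists v => //; exact: exec_PLoop0.
    move=> /exec_seqP[u pu /exec_seqP[w qw kw]].
    by exists w => //; exact: exec_PLoopS vi pu qw.
(* The continuation [k] is arbitrary, so that sequences and loops can push further programs on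
   it. *)
have run p u w : exec p u w -> forall k, runs k w v' -> runs (p :: k) u v'.
  elim=> {p u w} [u|i u|p q u v1 w _ IHp _ IHq|i p u ui|i p n u v1 w ui _ IHp _ IHq].
  - by move=> k' r; apply: runs_step r.
  - by move=> k' r; apply: runs_step r.
  - by move=> k' r; apply: (@runs_step _ _ [:: p, q & k'] u) => //; apply/IHp/IHq.
  - by move=> k' r; apply: runs_step r; rewrite /= ui.
  - move=> k' r; apply: (@runs_step _ _ [:: p, PLoop i p & k'] (upd u i n)).
      by rewrite /= ui.
    by apply/IHp/IHq.
elim: k v => [|p k IHk] v /=; first by move/exec_skipP->; exact: runs_nil.
by move=> /exec_seqP[u pu /IHk]; apply: run.
Qed.

Lemma prime_enum : {f : nat -> nat | injective f & forall i, prime (f i)}.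
Proof.
pose f := fix f i := if i is i'.+1 then s2val (prime_above (f i')) else 2.
have lt_f i j : i < j -> f i < f j.
  elim: j => // j IHj; rewrite ltnS leq_eqVlt /=.
  case: prime_above => p /= lt_p _ /predU1P[->//|/IHj ij]; exact: ltn_trans ij lt_p.
exists f; last by case=> //= i; case: prime_above.
by move=> i j eq_ij; case: (ltngtP i j) => // /lt_f; rewrite eq_ij ltnn.
Qed.

Definition pr := s2val prime_enum.

Lemma prime_pr i : prime (pr i).
Proof. exact: (s2valP' prime_enum). Qed.

Lemma pr_inj : injective pr.
Proof. exact: (s2valP prime_enum). Qed.

(** With the registers as exponents of distinct primes, each instruction acts on
    the Goedel number of the store by affine maps between residue classes. *)
Definition goedel K (v : store) := \prod_(i < K) pr i ^ v i.

Lemma goedel_inc K v i : i < K -> goedel K (upd v i (v i).+1) = goedel K v * pr i.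
Proof.
move=> iK; rewrite /goedel (bigD1 (Ordinal iK)) //= [in RHS](bigD1 (Ordinal iK)) //=.
rewrite /upd eqxx expnSr mulnAC.
by congr (_ * _ * _); apply: eq_bigr => j /negPf; rewrite -val_eqE /= => ->.
Qed.

(** This is how the zero test of a register becomes a condition on residues modulo a prime. *)
Lemma dvdn_goedel K v i : i < K -> (pr i %| goedel K v) = (0 < v i).
Proof.
move=> iK; apply/idP/idP => [|vi]; last first.
  by rewrite /goedel (bigD1 (Ordinal iK)) //= dvdn_mulr // dvdn_exp.
rewrite /goedel => /(big_ind (fun m => pr i %| m -> 0 < v i)); apply.
- by rewrite dvdn1 => /eqP e; have := prime_pr i; rewrite e.
- by move=> a b IHa IHb; rewrite Euclid_dvdM ?prime_pr // => /orP[].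
- move=> j _; case: (posnP (v j)) => [->|vj].
    by rewrite expn0 dvdn1 => /eqP e; have := prime_pr i; rewrite e.
  rewrite Euclid_dvdX ?prime_pr // vj andbT dvdn_prime2 ?prime_pr //.
  by move/eqP/pr_inj->.
Qed.

Lemma goedel_dec K v i n : i < K -> v i = n.+1 ->
  goedel K (upd v i n) = goedel K v %/ pr i.
Proof.
move=> iK vi; have {2}-> : v = upd (upd v i n) i (upd v i n i).+1.
  by rewrite /upd eqxx -vi; apply/funext => j; case: eqP => // ->.
by rewrite goedel_inc // mulnK // prime_gt0 // prime_pr.
Qed.

Definition next_num (k : stack) (n : nat) : stack * nat :=
  match k with
  | [::] => ([::], n)
  | PSkip :: k' => (k', n)
  | PInc i :: k' => (k', n * pr i)
  | PSeq p q :: k' => ([:: p, q & k'], n)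
  | PLoop i p :: k' => if pr i %| n then (p :: k, n %/ pr i) else (k', n)
  end.

(** An affine rule sees a single residue class, so leaving a loop takes one rule for each nonzero
    residue modulo [pr i]. *)
Definition stack_rules (k : stack) : seq (rule stack) :=
  match k with
  | [::] => [::]
  | PSkip :: k' => [:: Rule k 0 1 k' 0 1]
  | PInc i :: k' => [:: Rule k 0 1 k' 0 (pr i)]
  | PSeq p q :: k' => [:: Rule k 0 1 [:: p, q & k'] 0 1]
  | PLoop i p :: k' => Rule k 0 (pr i) (p :: k) 0 1 ::
      [seq Rule k j (pr i) k' j (pr i) | j <- iota 1 (pr i).-1]
  end.

Lemma stack_rules_sound k r u : r \in stack_rules k ->
  (dst r, rb r + u * rn r) = next_num k (ra r + u * rm r).
Proof.
have pr0 i : 0 < pr i by rewrite prime_gt0 // prime_pr.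
case: k => [//|[|i|p q|i p] k] /=; rewrite ?mem_seq1 ?in_cons;
  try by move/eqP->; rewrite /= !(add0n, muln1).
case/predU1P=> [->|/mapP[j]] /=; first by rewrite !add0n dvdn_mull // mulnK // muln1.
rewrite mem_iota => /andP[j0 jp] ->; rewrite ifF //=.
rewrite dvdn_addl ?dvdn_mull //; apply/negP => /dvdn_leq; have := pr0 i; lia.
Qed.

Lemma stack_rules_src k r : r \in stack_rules k -> src r = k.
Proof.
case: k => [//|[|i|p q|i p] k] /=; rewrite ?mem_seq1 ?in_cons; try by move/eqP->.
by case/predU1P=> [->|/mapP[j _ ->]].
Qed.

Lemma stack_rules_complete k n : k <> [::] ->
  exists2 r, r \in stack_rules k & exists u, n = ra r + u * rm r.
Proof.
have pr0 i : 0 < pr i by rewrite prime_gt0 // prime_pr.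
case: k => [//|[|i|p q|i p] k] _;
  try by eexists; [exact: mem_head | exists n; rewrite /= muln1].
have [/dvdnP[u ->]|ndvd] := boolP (pr i %| n).
  by eexists; [exact: mem_head | exists u].
exists (Rule (PLoop i p :: k) (n %% pr i) (pr i) k (n %% pr i) (pr i)).
  rewrite inE; apply/orP; right; apply/mapP; exists (n %% pr i) => //.
  rewrite mem_iota lt0n [_ == 0](negbTE ndvd) /=.
  by have := ltn_pmod n (pr0 i); lia.
by exists (n %/ pr i); rewrite /= addnC -divn_eq.
Qed.

Lemma stack_rules_lt k r : r \in stack_rules k -> ra r < rm r /\ rb r < rn r.
Proof.
have pr0 i : 0 < pr i by rewrite prime_gt0 // prime_pr.
case: k => [//|[|i|p q|i p] k] /=; rewrite ?mem_seq1 ?in_cons; try by move/eqP->; split=> /=.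
case/predU1P=> [->|/mapP[j]]; first by split=> //=.
rewrite mem_iota => jp -> /=; by have := pr0 i; lia.
Qed.

(** Every step changes the height of the stack by exactly one. *)
Lemma next_num_neq k n : k <> [::] -> (next_num k n).1 <> k.
Proof.
by case: k => [//|[|i|p q|i p] k] _ /=; try case: ifP => _; move=> /(congr1 size) /=; lia.
Qed.

Fixpoint reg_bound (p : prog) :=
  match p with
  | PSkip => 0
  | PInc i => i.+1
  | PSeq p q => maxn (reg_bound p) (reg_bound q)
  | PLoop i p => maxn i.+1 (reg_bound p)
  end.

Definition stack_bounded K (k : stack) := all (fun p => reg_bound p <= K) k.

Lemma next_num_goedel K k v k1 v1 : stack_bounded K k ->
  next_stack k v = Some (k1, v1) -> next_num k (goedel K v) = (k1, goedel K v1).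
Proof.
case: k => [|[|i|p q|i p] k] //=.
- by move=> _ [<- <-].
- by move=> /andP[iK _] [<- <-]; rewrite goedel_inc.
- by move=> _ [<- <-].
- move=> /andP[ipK _]; have iK : i < K by lia.
  rewrite dvdn_goedel //; case vi: (v i) => [|n] -[<- <-] //=.
  by rewrite (goedel_dec iK vi).
Qed.

(** All the stacks met when running [p] on top of the stack [k]. *)
Fixpoint conts (p : prog) (k : stack) : seq stack :=
  (p :: k) :: match p with
  | PSkip | PInc _ => [::]
  | PSeq p1 p2 => conts p1 (p2 :: k) ++ conts p2 k
  | PLoop _ p1 => conts p1 (p :: k)
  end.

Lemma mem_conts p k : p :: k \in conts p k.
Proof. by case: p => *; rewrite mem_head. Qed.

(** This closure property is why finitely many states suffice. *)
Lemma conts_next p k k' n : k' \in conts p k ->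
  (next_num k' n).1 \in k :: conts p k.
Proof.
elim: p k k' => [|i|p IHp q IHq|i p IHp] k k' /=; rewrite ?mem_seq1 ?in_cons.
- by move/eqP->; rewrite /= eqxx.
- by move/eqP->; rewrite /= eqxx.
- rewrite !mem_cat; case/predU1P=> [->|/orP[/IHp|/IHq]] /=.
  + by rewrite mem_conts !orbT.
  + rewrite in_cons; case/predU1P=> [->|->]; last by rewrite !orbT.
    by rewrite mem_conts !orbT.
  + by rewrite in_cons => /orP[]->; rewrite ?orbT.
- case/predU1P=> [->|/IHp] /=; last by rewrite in_cons => ->; rewrite orbT.
  by case: ifP => _ /=; rewrite ?eqxx // mem_conts !orbT.
Qed.

Lemma conts_bounded K p k k' : reg_bound p <= K -> stack_bounded K k ->
  k' \in conts p k -> stack_bounded K k'.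
Proof.
elim: p k k' => [|i|p IHp q IHq|i p IHp] k k' /= pK kK; rewrite ?mem_seq1 ?in_cons.
- by move/eqP->; apply/andP.
- by move/eqP->; apply/andP.
- rewrite mem_cat; case/predU1P=> [->|/orP[]].
  + by apply/andP.
  + by apply: IHp; [lia | apply/andP; split; [lia|]].
  + by apply: IHq; [lia|].
- case/predU1P=> [->|]; first by apply/andP.
  by apply: IHp; [lia | apply/andP].
Qed.

(** * The finite-state machine of a program *)

Section StackMachine.
Variable p0 : prog.

Definition states : seq stack := rcons (conts p0 [::]) [::].
Definition nstates := (size (conts p0 [::])).
Definition state (k : stack) : 'I_nstates.+1 := inord (index k states).

Lemma state_inj : {in states &, injective state}.
Proof.
move=> k k' k_s k'_s /(congr1 (@nat_of_ord _)); rewrite /state !inordK; first last.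
- by move: k_s; rewrite -index_mem {2}/states size_rcons.
- by move: k'_s; rewrite -index_mem {2}/states size_rcons.
by move=> e; rewrite -(nth_index [::] k_s) e nth_index.
Qed.

(** A start state with a fixed index makes the relator that encodes the input independent of the
    program. *)
Lemma state_start : state [:: p0] = ord0.
Proof.
apply: ord_inj; rewrite /state /states.
have -> : conts p0 [::] = [:: p0] :: behead (conts p0 [::]) by case: (p0).
by rewrite rcons_cons /= eqxx inordK.
Qed.

Lemma states_nil : [::] \in states.
Proof. by rewrite mem_rcons mem_head. Qed.

Lemma states_next k n : k \in states -> (next_num k n).1 \in states.
Proof.
rewrite !mem_rcons in_cons => /predU1P[->|/conts_next]; [exact: mem_head | exact].
Qed.

Definition state_rule (r : rule stack) :=
  Rule (state (src r)) (ra r) (rm r) (state (dst r)) (rb r) (rn r).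

Definition rule_list := flatten [seq stack_rules k | k <- states].
Definition nrules := size rule_list.
Definition rules (i : 'I_nrules) := state_rule (tnth (in_tuple rule_list) i).

Lemma rulesP i : exists2 k, k \in states & exists2 r, r \in stack_rules k &
  rules i = state_rule r.
Proof.
have /flatten_mapP[k k_s r_k] := mem_tnth i (in_tuple rule_list).
by exists k => //; eexists; first exact: r_k.
Qed.

(** Injectivity of [state] on [states] confines the applicable rules to those of [k]; their
    soundness and completeness make the step relation the graph of [next_num]. *)
Lemma rstep_state k n c : k \in states ->
  rstep rules (state k, n) c <->
  k <> [::] /\ c = (state (next_num k n).1, (next_num k n).2).
Proof.
move=> k_s; split.
  move=> [i [u e ->]]; have [k' k'_s [r r_k' ri]] := rulesP i.
  move: e; rewrite ri /state_rule /= (stack_rules_src r_k') => -[].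
  move=> /(state_inj k_s k'_s) ek ->.
  by rewrite ek -(stack_rules_sound u r_k') /=; split=> // k0; rewrite k0 in r_k'.
move=> [k0 ->]; have [r r_k [u ->]] := stack_rules_complete n k0.
have /tnthP[i ri] : r \in in_tuple rule_list by apply/flatten_mapP; exists k.
exists i; exists u; rewrite /rules -ri //= ?(stack_rules_src r_k) //.
by rewrite -(stack_rules_sound u r_k).
Qed.

Lemma rstep_srcP c c' : rstep rules c c' -> exists2 k, k \in states & c.1 = state k.
Proof.
move=> [i [u -> _]]; have [k k_s [r r_k ->]] := rulesP i.
by exists k; rewrite //= (stack_rules_src r_k).
Qed.

Lemma stack_machine_ok : machine_ok rules (state [::]).
Proof.
have rules_lt i : ra (rules i) < rm (rules i) /\ rb (rules i) < rn (rules i).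
  by have [k _ [r r_k ->]] := rulesP i; exact: stack_rules_lt r_k.
split=> [i|i|i|i|[q n] c1 c2]; try by case: (rules_lt i).
- have [k k_s [r r_k ->]] := rulesP i; rewrite /= (stack_rules_src r_k).
  rewrite [dst r](congr1 fst (stack_rules_sound 0 r_k)).
  have k0 : k <> [::] by move=> k0; rewrite k0 in r_k.
  move/(state_inj k_s (states_next _ k_s)) => e.
  exact: next_num_neq k0 (esym e).
- have [k k_s [r r_k ->]] := rulesP i; rewrite /= (stack_rules_src r_k).
  by move/(state_inj k_s states_nil) => k0; rewrite k0 in r_k.
- move=> s1; have [k k_s /= qE] := rstep_srcP s1; move: s1; rewrite qE.
  by move=> /rstep_state[//|_ ->] /rstep_state[//|_ ->].
Qed.

Let K := reg_bound p0.

Lemma states_bounded k : k \in states -> stack_bounded K k.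
Proof.
by rewrite mem_rcons in_cons => /predU1P[->//|]; apply: conts_bounded.
Qed.

Lemma next_stack_some k v : k <> [::] -> exists k1 v1, next_stack k v = Some (k1, v1).
Proof.
case: k => [//|[|i|p q|i p] k] _ /=; try by do 2 eexists.
by case: (v i) => [|n]; do 2 eexists.
Qed.

Lemma accepts_runs k v : k \in states ->
  accepts rules (state [::]) (state k, goedel K v) -> exists v', runs k v v'.
Proof.
move def_c: (_, _) => c k_s acc; elim: acc k v k_s def_c => {c} [|c c' st _ IH] k v k_s.
  by move=> [/(state_inj k_s states_nil) -> _]; exists v; exact: runs_nil.
move=> def_c; move: st; rewrite -def_c => /(rstep_state _ _ k_s)[k0 c'E].
have [k1 [v1 kv]] := next_stack_some v k0.
have nE := next_num_goedel (states_bounded k_s) kv.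
have [||v' r] := IH k1 v1.
- by have := states_next (goedel K v) k_s; rewrite nE.
- by rewrite c'E nE.
- by exists v'; exact: runs_step kv r.
Qed.

Lemma runs_accepts k v v' : k \in states -> runs k v v' -> goedel K v' = 1 ->
  accepts rules (state [::]) (state k, goedel K v).
Proof.
move=> k_s r v'1; elim: r k_s v'1 => {k v v'} [v _ ->|k v k1 v1 v' kv _ IH k_s v'1].
  exact: accepts_halt.
have nE := next_num_goedel (states_bounded k_s) kv.
have k1_s : k1 \in states by have := states_next (goedel K v) k_s; rewrite nE.
apply: accepts_step (IH k1_s v'1); apply/rstep_state => //; rewrite nE; split=> //.
by move=> k0; rewrite k0 in kv.
Qed.

End StackMachine.

Lemma goedel_start K x y : 1 < K -> goedel K (start_store x y) = pr 0 ^ x * pr 1 ^ y.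
Proof.
case: K => [|[|K]] // _; rewrite /goedel !big_ord_recl big1 /= ?muln1 //.
by move=> i _; rewrite /start_store /= nth_nil.
Qed.

Lemma machine_of_rec_fun (f : rec_fun 2) :
  exists nq nr (rs : 'I_nr -> rule 'I_nq.+1) (h : 'I_nq.+1), machine_ok rs h /\
    forall x y, accepts rs h (ord0, pr 0 ^ x * pr 1 ^ y) <->
                exists z, rec_eval f [tuple x; y] z.
Proof.
pose p := main_prog f.
exists (nstates p), (nrules p), (@rules p), (state p [::]).
split=> [|x y]; first exact: stack_machine_ok.
have p_s : [:: p] \in states p by rewrite mem_rcons in_cons mem_conts orbT.
have -> : ord0 = state p [:: p].
  by rewrite state_start.
have K1 : 1 < reg_bound p by rewrite /p /main_prog /=; lia.
rewrite -(goedel_start x y K1).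
have runE v : runs [:: p] (start_store x y) v <->
    (exists z, rec_eval f [tuple x; y] z) /\ v = fun=> 0.
  rewrite runsP /= -main_progP exec_seqP; split=> [[u pu /exec_skipP ->]//|pv].
  by exists v => //; exact: exec_PSkip.
split=> [/(accepts_runs p_s)[v /runE[]]//|fz].
apply: (runs_accepts p_s (v' := fun=> 0)); first exact/runE.
by rewrite /goedel big1.
Qed.

(** * Computable functions *)

Definition computable n (F : n.-tuple nat -> nat) :=
  exists f : rec_fun n, forall v, rec_eval f v (F v).

Definition computable1 (h : nat -> nat) := computable (fun v : 1.-tuple nat => h (thead v)).

Definition computable2 (h : nat -> nat -> nat) :=
  computable (fun v : 2.-tuple nat => h (tnth v ord0) (tnth v ord_max)).

Lemma computable_proj n (i : 'I_n) : computable (fun v => tnth v i).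
Proof. by exists (RecProj i). Qed.

Lemma computable_comp1 n h (F : n.-tuple nat -> nat) :
  computable1 h -> computable F -> computable (fun v => h (F v)).
Proof.
move=> [g gP] [f fP]; exists (RecComp g (fun=> f)) => v /=.
exists [tuple F v]; last exact: (gP [tuple F v]).
by move=> i; rewrite (ord1 i).
Qed.

Lemma computable_comp2 n h (F1 F2 : n.-tuple nat -> nat) :
  computable2 h -> computable F1 -> computable F2 ->
  computable (fun v => h (F1 v) (F2 v)).
Proof.
move=> [g gP] [f1 f1P] [f2 f2P].
exists (RecComp g (fun i => if i == ord0 then f1 else f2)) => v /=.
exists [tuple F1 v; F2 v]; last exact: (gP [tuple F1 v; F2 v]).
by case=> -[|[|//]] i.
Qed.

Lemma computable1_id : computable1 id.
Proof. by exists (RecProj ord0). Qed.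

Lemma computable1_succ : computable1 succn.
Proof. by exists RecSucc. Qed.

Lemma computable1_comp h1 h2 :
  computable1 h1 -> computable1 h2 -> computable1 (fun x => h1 (h2 x)).
Proof. exact: computable_comp1. Qed.

Lemma computable_const n c : computable (fun _ : n.-tuple nat => c).
Proof.
elim: c => [|c IHc]; last exact: computable_comp1 computable1_succ IHc.
have none : 'I_0 -> rec_fun n by case.
by exists (RecComp RecZero none) => v; exists [tuple] => //; case.
Qed.

Lemma computable2_iter h : computable1 h -> computable2 (fun k x => iter k h x).
Proof.
(* The step function of [RecPrim] receives the counter, the current value and the parameter; its
   argument 1 is the current value. *)
move=> [f fP]; exists (RecPrim (RecProj ord0) (RecComp f (fun=> RecProj (@Ordinal 3 1 isT)))).
move=> v /=; have -> : tnth v ord_max = tnth (behead_tuple v) ord0.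
  by case: v => -[|a [|b [|? ?]]].
rewrite -/(thead v); elim: (thead v) => //= k IHk.
exists (iter k h (tnth (behead_tuple v) ord0)) => //.
exists [tuple iter k h (tnth (behead_tuple v) ord0)]; last exact: (fP [tuple _]).
by move=> i; rewrite (ord1 i).
Qed.

Lemma computable1_iterl h x : computable1 h -> computable1 (fun k => iter k h x).
Proof.
move=> hP.
exact: computable_comp2 (computable2_iter hP) (computable_proj ord0) (computable_const 1 x).
Qed.

Lemma computable1_addl c : computable1 (addn c).
Proof.
elim: c => [|c IHc]; first exact: computable1_id.
exact: computable1_comp computable1_succ IHc.
Qed.

Lemma computable1_mull c : computable1 (muln c).
Proof.
have := computable1_iterl 0 (computable1_addl c); rewrite /computable1.
suff -> : (fun v : 1.-tuple nat => iter (thead v) (addn c) 0) = (fun v => c * thead v) by [].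
by apply/funext => v; rewrite iter_addn_0.
Qed.

Lemma computable2_expM p : computable2 (fun k x => p ^ k * x).
Proof.
have := computable2_iter (computable1_mull p); rewrite /computable2.
set F := fun _ => _; set G := fun _ => _; suff -> : F = G by [].
apply/funext => v; rewrite /F /G; elim: (tnth v ord0) => [|k IHk] /=.
  by rewrite mul1n.
by rewrite IHk expnS mulnA.
Qed.

(** Minimise a function that ignores its search variable and exchanges the answers 0 and 1 of [f]:
    the search succeeds at once on the answer 1 and never on the answer 0. *)
Lemma computable2_self_halting (f : rec_fun 1) D : computable2 D ->
  exists g : rec_fun 2, forall k m,
    (rec_eval f [tuple D k m] 1 -> exists z, rec_eval g [tuple k; m] z) /\
    (rec_eval f [tuple D k m] 0 -> ~ exists z, rec_eval g [tuple k; m] z).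
Proof.
move=> [d dP].
have [one oneP] : exists o : rec_fun 0, forall v, rec_eval o v 1.
  by have [o oP] := computable_const 0 1; exists o.
have [zero zeroP] : exists o : rec_fun 2, forall v, rec_eval o v 0.
  by have [o oP] := computable_const 2 0; exists o.
pose isz := RecPrim one zero.
have isz0 : rec_eval isz [tuple 0] 1 by exact: oneP.
have isz1 : rec_eval isz [tuple 1] 0.
  by exists 1; [exact: oneP | exact: zeroP].
(* Here [lift ord0] skips the search variable, which comes first. *)
pose fd : rec_fun 3 :=
  RecComp f (fun _ : 'I_1 => RecComp d (fun i : 'I_2 => RecProj (lift ord0 i))).
exists (RecMin (RecComp isz (fun=> fd))) => k m.
have fdP y b : rec_eval f [tuple D k m] b -> rec_eval fd [tuple of y :: [tuple k; m]] b.
  move=> fb; exists [tuple D k m] => // i; rewrite (ord1 i) /=.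
  exists [tuple k; m]; last exact: (dP [tuple k; m]).
  by case=> -[|[|//]] j.
have step y b c : rec_eval f [tuple D k m] b -> rec_eval isz [tuple b] c ->
    rec_eval (RecComp isz (fun=> fd)) [tuple of y :: [tuple k; m]] c.
  by move=> fb ib; exists [tuple b] => // i; rewrite (ord1 i); exact: fdP.
split=> [f1|f0 [z [fz _]]].
  by exists 0; split=> //; exact: step f1 isz1.
by have := rec_eval_fun (f := RecComp isz (fun=> fd)) fz (step z _ _ f0 isz0).
Qed.

(** * A criterion for property R_infty *)

Import GRing.Theory.
Local Open Scope classical_set_scope.
Local Open Scope group_scope.

Section AscendingHNN.
Variables (G : groupType) (A : set G) (gens : seq G) (t : G) (chi : G -> int).
Hypothesis A1 : A 1.
Hypothesis AM : forall x y, A x -> A y -> A (x * y).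
Hypothesis AV : forall x, A x -> A x^-1.
Hypothesis A_gens : forall B : set G, B 1 ->
  (forall x y, B x -> B y -> B (x * y)) -> (forall x, B x -> B x^-1) ->
  (forall x, x \in gens -> B x) -> A `<=` B.
Hypothesis gens_A : forall x, x \in gens -> A x.
Hypothesis chiM : forall x y, chi (x * y) = (chi x + chi y)%R.
Hypothesis chi_t : chi t = 1%R.
Hypothesis kerE : forall x, chi x = 0%R <-> exists n, A (t ^+ n * x * t ^- n).
Hypothesis A_t : forall x, A x -> A (t * x * t^-1).
Hypothesis A_nsub : exists2 x, A x & ~ A (t^-1 * x * t).
Hypothesis chi_uniq : forall psi : G -> int,
  (forall x y, psi (x * y) = (psi x + psi y)%R) ->
  exists c : int, forall x, psi x = (c * chi x)%R.

(** This is membership in the subgroup [t ^- n * A * t ^+ n]. *)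
Let An n x := A (t ^+ n * x * t ^- n).

Let AnS n x : An n x -> An n.+1 x.
Proof.
by rewrite /An => /A_t; rewrite expgS invgM !mulgA.
Qed.

Let An_conj n x : An n (t * x * t^-1) = An n.+1 x.
Proof. by rewrite /An expgSr invgM !mulgA. Qed.

Let An_le n m x : n <= m -> An n x -> An m x.
Proof.
move=> /subnK <-; elim: (m - n) => //= k IHk /IHk; rewrite addSn; exact: AnS.
Qed.

Let AnM n x y : An n x -> An n y -> An n (x * y).
Proof. by move=> /AM /[apply]; rewrite /An !mulgA mulgVK. Qed.

Let AnV n x : An n x -> An n x^-1.
Proof. by move=> /AV; rewrite /An !invgM invgK !mulgA. Qed.

Let An1 n : An n 1.
Proof. by rewrite /An mulg1 mulgV. Qed.

Let chi1 : chi 1 = 0%R.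
Proof. by have := chiM 1 1; rewrite mulg1 -[LHS]addr0 => /addrI. Qed.

Let chiV x : chi x^-1 = (- chi x)%R.
Proof. by apply/eqP; rewrite -addr_eq0 -chiM mulVg chi1. Qed.

(** If [phi] reverses [chi], then the kernel of [chi], which is the union of the
    strictly increasing sequence [An n], is also the union of the conjugates of
    [phi A] by the powers of [phi t]; as [A] is finitely generated, all of these
    lie in a single [An n]. *)
Lemma no_reversal (phi : G -> G) :
  automorphism phi -> ~ (forall x, chi (phi x) = - chi x)%R.
Proof.
move=> [[psi phiK psiK] phiM] chi_phi.
have phi1 : phi 1 = 1 by have := phiM 1 1; rewrite mulg1 -{1}[phi 1]mulg1 => /mulgI.
have phiV x : phi x^-1 = (phi x)^-1.
  by apply: (@mulgI _ (phi x)); rewrite -phiM !mulgV.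
have phiX x n : phi (x ^+ n) = phi x ^+ n.
  by elim: n => [|n IHn]; rewrite ?expg0 // !expgS phiM IHn.
have [n0 gens_n0] : exists n, forall x, x \in gens -> An n (phi x).
  elim: (gens) gens_A => [|g s IHs] sA; first by exists 0.
  have [|n sn] := IHs; first by move=> x xs; apply: sA; rewrite inE xs orbT.
  have [m gm] : exists m, An m (phi g).
    apply/kerE; rewrite chi_phi (_ : chi g = 0%R) ?oppr0 //; apply/kerE.
    by exists 0; rewrite expg0 invg1 mul1g mulg1; apply: sA; rewrite mem_head.
  exists (maxn n m) => x; rewrite inE => /predU1P[->|/sn xn].
    by apply: An_le gm; rewrite leq_maxr.
  by apply: An_le xn; rewrite leq_maxl.
(* As [phi] reverses [chi], this product lies in the kernel: up to it, [phi t] is the inverse of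
   [t], and conjugation by either preserves a large enough [An n]. *)
pose k := phi t * t.
have [n1 k_n1] : exists n, An n k.
  by apply/kerE; rewrite chiM chi_phi chi_t addNr.
pose n := maxn n0 n1.
have k_n : An n k by apply: An_le k_n1; rewrite leq_maxr.
have phiA_n x : A x -> An n (phi x).
  apply: (A_gens (B := fun x => An n (phi x))) => [|y z By Bz|y By|y y_gens].
  - by rewrite phi1; exact: An1.
  - by rewrite phiM; exact: AnM.
  - by rewrite phiV; exact: AnV.
  - by apply: An_le (gens_n0 _ y_gens); rewrite leq_maxl.
have conj_n x : An n x -> An n ((phi t)^-1 * x * phi t).
  have -> : phi t = k * t^-1 by rewrite /k mulgK.
  rewrite invgM invgK => xn.
  have : An n (k^-1 * x * k) by apply: AnM => //; apply: AnM => //; exact: AnV.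
  by move/AnS; rewrite -An_conj !mulgA.
(* As [x = phi (psi x)], some conjugate of [x] by a power of [phi t] lies in [An n]; [conj_n] undoes
   the conjugation one factor at a time. *)
have ker_n x : chi x = 0%R -> An n x.
  move=> chix; have /kerE[m xm] : chi (psi x) = 0%R.
    by apply/eqP; rewrite -oppr_eq0 -chi_phi psiK chix.
  have := phiA_n _ xm; rewrite !phiM phiV !phiX psiK.
  elim: m x {chix xm} => [|m IHm] x; first by rewrite expg0 invg1 mul1g mulg1.
  by rewrite expgS invgM => /conj_n; rewrite !mulgA mulVg mul1g mulgVK => /IHm.
have [x Ax nAx] := A_nsub; apply: nAx.
(* This conjugate lies in [An n.+1], hence in the kernel, hence in [An n], which says that
   [t^-1 * x * t] lies in [A]. *)
have : An n (t ^- n.+1 * x * t ^+ n.+1).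
  apply: ker_n; apply/kerE; exists n.+1.
  by rewrite !mulgA mulgV mul1g mulgK.
by rewrite /An expgS invgM !mulgA mulgV mul1g mulgK.
Qed.

(** An automorphism multiplies [chi] by a constant, which is invertible because the inverse
    automorphism does so too. [no_reversal] excludes [-1], so the powers of [t] lie in distinct
    classes. *)
Lemma R_infty_of_ascending : R_infty G.
Proof.
move=> phi phi_aut; have [phi_bij phiM] := phi_aut.
have [c phi_c] : exists c : int, forall x, chi (phi x) = (c * chi x)%R.
  by apply: chi_uniq => x y; rewrite phiM chiM.
have c_unit : exists d : int, (d * c = 1)%R.
  have [psi phiK psiK] := phi_bij.
  have psiM : {morph psi : x y / x * y}.
    by move=> x y; apply: (can_inj phiK); rewrite phiM !psiK.
  have [d psi_d] : exists d : int, forall x, chi (psi x) = (d * chi x)%R.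
    by apply: chi_uniq => x y; rewrite psiM chiM.
  by exists d; have := psi_d (phi t); rewrite phiK phi_c chi_t mulr1.
have {c_unit} c1 : c = 1%R.
  have [d dc] := c_unit; have : c = 1%R \/ c = (-1)%R.
    have := congr1 absz dc; rewrite abszM => /eqP; rewrite muln_eq1; lia.
  case=> // cN; case: (no_reversal phi_aut) => x.
  by rewrite phi_c cN mulN1r.
have tw x y : twisted_conj phi x y -> chi x = chi y.
  by move=> [w <-]; rewrite !chiM chiV phi_c c1 mul1r addrAC subrr add0r.
have chi_tX n : chi (t ^+ n) = n%:R%R.
  elim: n => [|n IHn]; first by rewrite expg0 chi1.
  by rewrite expgS chiM IHn chi_t -natr1 addrC.
pose F n := [set y | twisted_conj phi (t ^+ n) y].
have F_inj : injective F.
  move=> m n /(congr1 (fun C : set G => C (t ^+ n))) /= e.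
  have /tw : F m (t ^+ n).
    rewrite e; exists 1; rewrite invg1 mulg1; have := phiM 1 1.
    by rewrite mulg1 -{1}[phi 1]mulg1 => /mulgI <-; rewrite mul1g.
  by rewrite !chi_tX !natz => -[].
move=> fin; apply: infinite_nat.
rewrite -(eq_finite_set (inj_card_eq (f := F) _)); last by move=> ? ? _ _ /F_inj.
by apply: sub_finite_set fin => _ [n _ <-]; exists (t ^+ n).
Qed.
End AscendingHNN.

(** * Presentations by equations between positive words *)

Local Open Scope classical_set_scope.
Local Open Scope group_scope.

Lemma word_classM (P : presentation) (u v : word (ngens P)) :
  word_class (u ++ v) = word_class u * word_class v :> presented_group P.
Proof. exact: word_class_cat. Qed.

Lemma word_classV (P : presentation) (w : word (ngens P)) :
  word_class (inv_word w) = (word_class w)^-1 :> presented_group P.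
Proof.
apply: (@mulgI _ (word_class w)); rewrite mulgV -word_classM.
exact/word_classP/word_eq_mulV.
Qed.

Section EquationalPresentation.
Variables (T : eqType) (N : nat) (idx : T -> 'I_N) (gen_of : 'I_N -> T).
Hypothesis idxK : cancel idx gen_of.
Hypothesis gen_ofK : cancel gen_of idx.

(** With equations between positive words, relations can be checked by folding over the generators
    alone, without inverse letters. *)
Definition pos_word (u : seq T) : word N := [seq (idx x, false) | x <- u].

Definition eq_relator (e : seq T * seq T) : word N :=
  pos_word e.1 ++ inv_word (pos_word e.2).

Variable eqs : seq (seq T * seq T).

Definition eq_pres := Presentation [seq eq_relator e | e <- eqs].
Let P := eq_pres.
Let G := presented_group P.

Definition pgen (x : T) : G := @word_class P [:: (idx x, false)].

Definition gprod (H : groupType) (f : T -> H) (u : seq T) : H :=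
  foldr (fun x g => f x * g) 1 u.

Lemma gprod_cat (H : groupType) (f : T -> H) u v :
  gprod f (u ++ v) = gprod f u * gprod f v.
Proof. by elim: u => [|x u IHu] /=; rewrite ?mul1g // IHu mulgA. Qed.

Lemma word_class_pos u : @word_class P (pos_word u) = gprod pgen u.
Proof.
elim: u => [//|x u IHu]; rewrite /= -IHu.
exact: (word_classM (P := P) [:: _]).
Qed.

Lemma pgen_eq e : e \in eqs -> gprod pgen e.1 = gprod pgen e.2.
Proof.
move=> e_eqs; have : @word_class P (eq_relator e) = 1.
  by apply/word_classP/word_eq_relator/map_f.
rewrite [LHS](word_classM (P := P)) (word_classV (P := P)) !word_class_pos.
exact: divg1_eq.
Qed.

Lemma pres_ind (Q : G -> Prop) : Q 1 -> (forall x g, Q g -> Q (pgen x * g)) ->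
  (forall x g, Q g -> Q ((pgen x)^-1 * g)) -> forall g, Q g.
Proof.
move=> Q1 Qp Qn; apply: word_class_ind => w.
elim: w => [//|[i b] w IHw].
rewrite [word_class _](word_classM (P := P) [:: (i, b)]).
rewrite -(gen_ofK i); case: b; last exact: Qp.
rewrite (_ : word_class _ = (pgen (gen_of i))^-1); first exact: Qn.
by rewrite /pgen -word_classV.
Qed.

(** The universal property of the presentation, for permutations of [X]: the action of words is
    invariant under [word_eq], so it can be computed on representatives. *)
Lemma pres_act (X : Type) (s s' : T -> X -> X) :
  (forall a, cancel (s a) (s' a)) -> (forall a, cancel (s' a) (s a)) ->
  (forall e, e \in eqs -> forall x, foldr s x e.1 = foldr s x e.2) ->
  exists rho : G -> X -> X,
    [/\ forall x, rho 1 x = x, forall g h x, rho (g * h) x = rho g (rho h x)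
      & forall a x, rho (pgen a) x = s a x].
Proof.
move=> sK s'K s_eqs.
pose sl (l : 'I_N * bool) := if l.2 then s' (gen_of l.1) else s (gen_of l.1).
pose act (w : word N) x := foldr sl x w.
have act_cat u v x : act (u ++ v) x = act u (act v x) by exact: foldr_cat.
have slK l x : sl l (sl (inv_letter l) x) = x.
  by case: l => i []; rewrite /sl /= ?sK ?s'K.
have slVK l x : sl (inv_letter l) (sl l x) = x.
  by case: l => i []; rewrite /sl /= ?sK ?s'K.
have actV w x : act (inv_word w) (act w x) = x.
  elim: w x => [//|l w IHw] x; rewrite /inv_word /= rev_cons -cats1 act_cat.
  have -> : act [:: inv_letter l] (act (l :: w) x) = act w x by exact: slVK.
  exact: IHw.
have act_pos u x : act (pos_word u) x = foldr s x u.
  by elim: u => //= a u ->; rewrite /sl /= idxK.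
have act_eq (u v : word N) : @word_eq P u v -> act u =1 act v.
  elim=> {u v} [u x|u v _ IH x|u v w _ IH1 _ IH2 x|u u' v v' _ IH1 _ IH2 x|l x|r].
  - by [].
  - by rewrite IH.
  - by rewrite IH1.
  - by rewrite !act_cat IH2 IH1.
  - exact: slK.
  - move=> /mapP[e e_eqs ->] x; rewrite act_cat.
    have inj_act w : injective (act w) by apply: can_inj; exact: actV.
    set y := act (inv_word _) x; rewrite act_pos s_eqs // -act_pos.
    by rewrite /y -{1}[pos_word e.2](inv_wordK (P := P)) actV.
exists (fun g => act (repr g)); split.
- by move=> x; exact: act_eq (repr_word_class _) x.
- move=> g h x; rewrite -act_cat; exact: act_eq (repr_word_class _) x.
- by move=> a x; rewrite (act_eq _ _ (repr_word_class _)) /act /= /sl /= idxK.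
Qed.

End EquationalPresentation.

(** * The presentation attached to a machine *)

Local Open Scope group_scope.

Section Generators.
Variables (nq nr : nat).

(** [US] names the start configuration and [UR j] exchanges the two sides of rule [j]. Translations
    are written as products of two involutions, [UE UF] on all configurations and [UY j UZ j] along
    the source of rule [j], so that every generator here is an involution. *)
Inductive ugen :=
| UE | UF | US | UK
| UT of 'I_nq
| UR of 'I_nr | UY of 'I_nr | UZ of 'I_nr.

Inductive gen := GU of ugen | GC of ugen | GB | GW | GD | GT.

HB.instance Definition _ := gen_eqMixin ugen.
HB.instance Definition _ := gen_eqMixin gen.

Definition nugen := (4 + (nq + (nr + (nr + nr))))%N.

(** The order gives the letters of the input relator indices that do not depend on [nq] or [nr]. *)
Definition uidx (x : ugen) : 'I_nugen :=
  match x with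
  | UE => lshift _ (@Ordinal 4 0 isT)
  | UF => lshift _ (@Ordinal 4 1 isT)
  | US => lshift _ (@Ordinal 4 2 isT)
  | UK => lshift _ (@Ordinal 4 3 isT)
  | UT q => rshift _ (lshift _ q)
  | UR j => rshift _ (rshift _ (lshift _ j))
  | UY j => rshift _ (rshift _ (rshift _ (lshift _ j)))
  | UZ j => rshift _ (rshift _ (rshift _ (rshift _ j)))
  end.

Definition ugen_of (i : 'I_nugen) : ugen :=
  match split i with
  | inl k => nth UE [:: UE; UF; US; UK] k
  | inr i => match split i with
    | inl q => UT q
    | inr i => match split i with
      | inl j => UR j
      | inr i => match split i with inl j => UY j | inr j => UZ j end
      end
    end
  end.

Let split_lshift m n (i : 'I_m) : split (lshift n i) = inl i :> 'I_m + 'I_n.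
Proof. exact: (unsplitK (inl i)). Qed.

Let split_rshift m n (i : 'I_n) : split (rshift m i) = inr i :> 'I_m + 'I_n.
Proof. exact: (unsplitK (inr i)). Qed.

Lemma uidxK : cancel uidx ugen_of.
Proof.
by case=> [||||q|j|j|j]; rewrite /ugen_of /uidx !(split_lshift, split_rshift).
Qed.

Lemma ugen_ofK : cancel ugen_of uidx.
Proof.
move=> i; rewrite /ugen_of; case: split_ordP => k ->.
  by case: k => -[|[|[|[|//]]]] ? /=; apply/val_inj.
case: split_ordP => {i}i -> //; case: split_ordP => {k}k -> //.
by case: split_ordP => {i}i ->.
Qed.

Definition ngen := (nugen + (nugen + 4))%N.

Definition gidx (x : gen) : 'I_ngen :=
  match x with
  | GU u => lshift _ (uidx u)
  | GC u => rshift _ (lshift _ (uidx u))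
  | GB => rshift _ (rshift _ (@Ordinal 4 0 isT))
  | GW => rshift _ (rshift _ (@Ordinal 4 1 isT))
  | GD => rshift _ (rshift _ (@Ordinal 4 2 isT))
  | GT => rshift _ (rshift _ (@Ordinal 4 3 isT))
  end.

Definition gen_of (i : 'I_ngen) : gen :=
  match split i with
  | inl i => GU (ugen_of i)
  | inr i => match split i with
    | inl i => GC (ugen_of i)
    | inr i => nth GB [:: GB; GW; GD; GT] i
    end
  end.

Lemma gidxK : cancel gidx gen_of.
Proof.
by case=> [u|u||||]; rewrite /gen_of /gidx !(split_lshift, split_rshift) ?uidxK.
Qed.

Lemma gen_ofK : cancel gen_of gidx.
Proof.
move=> i; rewrite /gen_of; case: split_ordP => k -> /=; first by rewrite ugen_ofK.
case: split_ordP => {i}i -> /=; first by rewrite ugen_ofK.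
by case: i => -[|[|[|[|//]]]] ? /=; apply/val_inj.
Qed.

Definition all_ugen := [seq ugen_of i | i <- enum 'I_nugen].

Lemma mem_all_ugen u : u \in all_ugen.
Proof. by rewrite -(uidxK u) map_f // mem_enum. Qed.

Variables (rs : 'I_nr -> rule 'I_nq) (q0 h : 'I_nq).

(** [x := UE UF] has inverse [UF UE]; the configuration [(q, n)] is encoded by
    [x ^ n * UT q * x ^ - n]. *)
Definition ux n := flatten (nseq n [:: UE; UF]).
Definition uxV n := flatten (nseq n [:: UF; UE]).
Definition uconf q n := ux n ++ UT q :: uxV n.

Definition start_eq n : seq ugen * seq ugen := (US :: uconf q0 n, [::]).

(** As [z] commutes with [x ^ rm] and [z ^ -1 x ^ rm] commutes with [c], conjugating [c] by powers
    of [x ^ rm] is conjugating it by powers of [z]; likewise for [z'] and [c']. The one equation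
    between [c] and [c'] then yields every instance of the rule. *)
Definition rule_eqs j : seq (seq ugen * seq ugen) :=
  let r := rs j in
  let z := [:: UY j; UZ j] in
  let zV := [:: UZ j; UY j] in
  let z' := UR j :: z ++ [:: UR j] in
  let zV' := UR j :: zV ++ [:: UR j] in
  let c := uconf (src r) (ra r) in
  let c' := uconf (dst r) (rb r) in
  [:: (z ++ ux (rm r), ux (rm r) ++ z);
      ((zV ++ ux (rm r)) ++ c, c ++ (zV ++ ux (rm r)));
      (z' ++ ux (rn r), ux (rn r) ++ z');
      ((zV' ++ ux (rn r)) ++ c', c' ++ (zV' ++ ux (rn r)));
      (UR j :: c ++ [:: UR j], c');
      ([:: UK; UR j], [:: UR j; UK])].

Definition ugen_eqs : seq (seq ugen * seq ugen) :=
  (UK :: uconf h 1, uconf h 1 ++ [:: UK]) ::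
  [seq ([:: u; u], [::]) | u <- all_ugen] ++
  flatten [seq rule_eqs j | j <- enum 'I_nr].

Definition lift_eq (e : seq ugen * seq ugen) := (map GU e.1, map GU e.2).

(** [GC u] completes [GB] and [GU u] to Coxeter generators of the symmetric
    group of degree 4, hence [GB = 1] forces [GC u = GU u = 1]; likewise with
    [GW], the commutator [KSKS] and [GB]. *)
Definition killer_eqs u : seq (seq gen * seq gen) :=
  [:: ([:: GB; GU u], [:: GU u; GB]);
      ([:: GC u; GC u], [::]);
      ([:: GB; GC u; GB; GC u; GB; GC u], [::]);
      ([:: GC u; GU u; GC u; GU u; GC u; GU u], [::]);
      ([:: GT; GU u], [:: GU u; GT]);
      ([:: GT; GC u], [:: GC u; GT])].

Definition top_eqs : seq (seq gen * seq gen) :=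
  let w := [:: GU UK; GU US; GU UK; GU US] in
  [:: ([:: GB; GB], [::]);
      ([:: GW; GW], [::]);
      ([:: GB; GW; GB; GW; GB; GW], [::]);
      (GW :: w ++ GW :: w ++ GW :: w, [::]);
      ([:: GB; GD; GB; GD], [::]);
      ([:: GT; GD], [:: GD; GD; GT]);
      ([:: GT; GB], [:: GB; GT]);
      ([:: GT; GW], [:: GW; GT])].

(** Keeping these equations free of the input allows the input to be chosen afterwards from their
    code. *)
Definition fixed_eqs := [seq lift_eq e | e <- ugen_eqs] ++
  flatten [seq killer_eqs u | u <- all_ugen] ++ top_eqs.

Definition machine_eqs n := lift_eq (start_eq n) :: fixed_eqs.

Definition machine_pres n := eq_pres gidx (machine_eqs n).

End Generators.

(** * Consequences of the relations in an arbitrary group *)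

Section Collapse.
Variables (nq nr : nat) (rs : 'I_nr -> rule 'I_nq) (q0 h : 'I_nq) (n : nat).
Variables (G : groupType) (g : gen nq nr -> G).
Hypothesis g_eqs : forall e, e \in machine_eqs rs q0 h n -> gprod g e.1 = gprod g e.2.

Notation gu u := (g (GU u)).
Local Notation E := (gu (UE _ _)).
Local Notation F := (gu (UF _ _)).
Local Notation S := (gu (US _ _)).
Local Notation K := (gu (UK _ _)).
Local Notation B := (g (GB _ _)).
Local Notation W := (g (GW _ _)).
Local Notation D := (g (GD _ _)).
Local Notation T := (g (GT _ _)).

Lemma gprod_map u : gprod g (map (@GU _ _) u) = gprod (fun x => gu x) u.
Proof. by elim: u => //= x u ->. Qed.

Lemma ugen_eq e : e \in ugen_eqs rs h ->
  gprod (fun u => gu u) e.1 = gprod (fun u => gu u) e.2.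
Proof.
move=> e_u; rewrite -!gprod_map; apply: (g_eqs (e := lift_eq e)).
by rewrite in_cons !mem_cat map_f ?orbT.
Qed.

Lemma killer_eq u e : e \in killer_eqs u -> gprod g e.1 = gprod g e.2.
Proof.
move=> e_u; apply: g_eqs; rewrite in_cons !mem_cat; apply/orP; right.
by apply/or3P/Or32/flatten_mapP; exists u => //; exact: mem_all_ugen.
Qed.

Lemma top_eq e : e \in top_eqs nq nr -> gprod g e.1 = gprod g e.2.
Proof. by move=> e_u; apply: g_eqs; rewrite in_cons !mem_cat e_u !orbT. Qed.

Lemma gu_invol u : gu u * gu u = 1.
Proof.
have /ugen_eq : ([:: u; u], [::]) \in ugen_eqs rs h.
  by rewrite in_cons mem_cat map_f ?orbT // mem_all_ugen.
by rewrite /= mulg1.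
Qed.

Lemma rule_eq j e : e \in rule_eqs rs j ->
  gprod (fun u => gu u) e.1 = gprod (fun u => gu u) e.2.
Proof.
move=> e_j; apply: ugen_eq; rewrite in_cons mem_cat; apply/orP; right.
by apply/orP; right; apply/flatten_mapP; exists j; rewrite ?mem_enum.
Qed.

Lemma rule_eqN j i : i < 6 -> let e := nth ([::], [::]) (rule_eqs rs j) i in
  gprod (fun u => gu u) e.1 = gprod (fun u => gu u) e.2.
Proof. by move=> i6 e; apply: (@rule_eq j); exact: (@mem_nth _ _ (rule_eqs rs j)) i6. Qed.

Let x := E * F.
Let conf q m := x ^+ m * gu (UT _ q) * x ^- m.

Lemma guV u : (gu u)^-1 = gu u.
Proof. by apply: mulg1_eq; exact: gu_invol. Qed.

Lemma gprod_ux m : gprod (fun u => gu u) (ux nq nr m) = x ^+ m.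
Proof. by elim: m => [//|m IHm]; rewrite expgS -IHm /= mulgA. Qed.

Lemma gprod_uconf q m : gprod (fun u => gu u) (uconf nr q m) = conf q m.
Proof.
have xV : F * E = x^-1 by rewrite /x invgM !guV.
have uxVE : gprod (fun u => gu u) (uxV nq nr m) = x ^- m.
  by elim: m => [|m IHm]; rewrite ?invg1 // expgSr invgM -IHm -xV /= mulgA.
by rewrite /uconf gprod_cat gprod_ux /= uxVE mulgA.
Qed.

(** [y ^+ k] is [z ^+ k] times a power of [z^-1 * y], and conjugation by that power fixes [c]. *)
Lemma shift_conj (z y c : G) k : commute z y -> commute (z^-1 * y) c ->
  y ^+ k * c * y ^- k = z ^+ k * c * z ^- k.
Proof.
move=> zy wc; have -> : y = z * (z^-1 * y) by rewrite mulVKg.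
have zw : commute z (z^-1 * y).
  by apply: commuteM => //; apply: commuteV; exact: commute_refl.
have e : (z^-1 * y) ^+ k * c * (z^-1 * y) ^- k = c.
  by rewrite -(commuteX k (commute_sym wc)) mulgK.
by rewrite expgMn // invgM -[c in RHS]e !mulgA.
Qed.

(** By [shift_conj], powers of [Z] replace powers of [x ^+ rm r] on the source, and powers of
    [R * Z * R] replace those of [x ^+ rn r] on the target; conjugation by [R] takes one to the
    other. *)
Lemma conf_rule j k (r := rs j) :
  gu (UR _ j) * conf (src r) (ra r + k * rm r)%N * gu (UR _ j) =
  conf (dst r) (rb r + k * rn r)%N.
Proof.
set R := gu (UR _ j); set Z := gu (UY _ j) * gu (UZ _ j).
have RR : R * R = 1 by exact: gu_invol.
have RV : R^-1 = R by exact: guV.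
have ZV : gu (UZ _ j) * gu (UY _ j) = Z^-1 by rewrite /Z invgM !guV.
have eqN := rule_eqN j.
pose simp := (gprod_uconf, gprod_ux, gprod_cat).
have confD q a m l : conf q (a + l * m)%N = (x ^+ m) ^+ l * conf q a * (x ^+ m) ^- l.
  by rewrite /conf addnC mulnC expgnDr invgM expgnA !mulgA.
have c1 : commute Z (x ^+ rm r).
  by have := eqN 0%N isT; rewrite /= !simp /= mulg1 mulgA.
have c2 : commute (Z^-1 * x ^+ rm r) (conf (src r) (ra r)).
  by have := eqN 1%N isT; rewrite /= !simp /= ?simp /commute -ZV !mulgA.
have c3 : commute (R * Z * R) (x ^+ rn r).
  by have := eqN 2%N isT; rewrite /= !simp /= ?simp ?mulg1 /commute /Z !mulgA.
have ZRV : R * Z^-1 * R = (R * Z * R)^-1.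
  by rewrite (invgM (R * Z)) (invgM R) RV mulgA.
have c4 : commute ((R * Z * R)^-1 * x ^+ rn r) (conf (dst r) (rb r)).
  by have := eqN 3%N isT; rewrite /= !simp /= ?simp ?mulg1 /commute -ZRV -ZV !mulgA.
have c5 : R * conf (src r) (ra r) * R = conf (dst r) (rb r).
  by have := eqN 4%N isT; rewrite /= !simp /= ?simp ?mulg1 mulgA.
have RX y k' : (R * y * R) ^+ k' = R * y ^+ k' * R.
  elim: k' => [|k' IHk]; first by rewrite mulg1 RR.
  by rewrite !expgS IHk -!mulgA [R * (R * _)]mulgA RR mul1g.
rewrite !confD (shift_conj _ c1 c2) (shift_conj _ c3 c4) -c5 RX !invgM [R^-1]guV.
by rewrite !mulgA -!(mulgA _ R R) RR !mulg1.
Qed.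

Lemma commute_K_UR j : commute K (gu (UR _ j)).
Proof.
by have := rule_eqN j (i := 5) isT; rewrite /= !mulg1.
Qed.

Lemma commute_K_accepts c : accepts rs h c -> commute K (conf c.1 c.2).
Proof.
elim=> {c} [|c c' [j [k -> ->]] _ /= IH].
  have confE q m : (UK _ _ :: uconf _ q m, uconf _ q m ++ [:: UK nq nr]) \in
      ugen_eqs rs h -> commute K (conf q m).
    by move/ugen_eq; rewrite /= gprod_uconf gprod_cat gprod_uconf /= mulg1.
  by apply: confE; exact: mem_head.
set R := gu (UR _ j); have RR : R * R = 1 by exact: gu_invol.
rewrite -conf_rule -/R in IH.
move: (conf (src (rs j)) _) IH => y IH.
have -> : y = R * (R * y * R) * R by rewrite !mulgA RR mul1g -mulgA RR mulg1.
have KR := commute_K_UR j; rewrite -/R in KR.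
by apply: commuteM => //; apply: commuteM.
Qed.

(** When two involutions have a product of order dividing 3 and one of them is trivial, the square
    and the cube of the other are trivial. This spreads from the commutator of [K] and [S] to [W],
    [B], each [GC u] and each [GU u]. *)
Lemma machine_collapse : accepts rs h (q0, n) -> forall a, a <> GT _ _ -> g a = 1.
Proof.
move=> acc.
have cK := commute_K_accepts acc; rewrite /= in cK.
have SE : S = conf q0 n.
  have := g_eqs (mem_head _ _); rewrite gprod_map /= gprod_uconf.
  by move/mulg1_eq; rewrite guV.
have topN i : i < 8 -> let e := nth ([::], [::]) (top_eqs nq nr) i in
    gprod g e.1 = gprod g e.2.
  by move=> i8 e; apply: top_eq; exact: (@mem_nth _ _ (top_eqs nq nr)) i8.
have KSKS y : K * (S * (K * (S * y))) = y.
  have SS : S * S = 1 by exact: gu_invol.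
  have KK : K * K = 1 by exact: gu_invol.
  rewrite -SE in cK; rewrite !mulgA cK -[S * K * K]mulgA KK mulg1 SS mul1g //.
have cube1 (y : G) : y * y = 1 -> y * (y * (y * 1)) = 1 -> y = 1.
  by move=> yy; rewrite mulg1 yy mulg1.
have W1 : W = 1.
  by apply: cube1; [have := topN 1%N isT | have := topN 3%N isT]; rewrite /= ?KSKS ?mulg1.
have B1 : B = 1.
  apply: cube1; first by have := topN 0%N isT; rewrite /= mulg1.
  by have := topN 2%N isT; rewrite /= W1 !mul1g.
have killN u i : i < 6 -> let e := nth ([::], [::]) (killer_eqs u) i in
    gprod g e.1 = gprod g e.2.
  by move=> i6 e; apply: (@killer_eq u); exact: (@mem_nth _ _ (killer_eqs u)) i6.
have C1 u : g (GC u) = 1.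
  apply: cube1; first by have := killN u 1%N isT; rewrite /= mulg1.
  by have := killN u 2%N isT; rewrite /= B1 !mul1g.
(* With [B = 1] one relation says that [D] has trivial square, and then [T * D = D * D * T] gives
   [T * D = T]. *)
have D1 : D = 1.
  have := topN 5%N isT; have := topN 4%N isT; rewrite /= B1 !mul1g !mulg1 mulgA => ->.
  by rewrite mul1g -{2}[T]mulg1 => /mulgI.
case=> // u _; apply: cube1; first exact: gu_invol.
by have := killN u 3%N isT; rewrite /= C1 !mul1g.
Qed.

End Collapse.

(** * The group of a machine *)

Import GRing.Theory Num.Theory.
Local Open Scope classical_set_scope.
Local Open Scope group_scope.

(** The group is abelian, so for inversion [x] is twisted conjugate to [w * w * x]; every element
    being a square or a square times [t], at most two classes remain. *)
Lemma not_R_infty_cyclic (G : groupType) (t : G) :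
  (forall Q : G -> Prop, Q 1 -> (forall g, Q g -> Q (t * g)) ->
     (forall g, Q g -> Q (t^-1 * g)) -> forall g, Q g) -> ~ R_infty G.
Proof.
move=> t_ind.
have comm_t g : commute t g.
  elim/t_ind: g => [|g tg|g tg]; first exact: commute1.
  - by apply: commuteM.
  - by apply: commuteM => //; exact: commuteV.
have comm (g g' : G) : commute g g'.
  move: g'; apply: (t_ind (commute g)) => [|g' gg'|g' gg']; first exact: commute1.
  - by apply: commuteM => //; exact: commute_sym (comm_t g).
  - by apply: commuteM => //; apply: commuteV; exact: commute_sym (comm_t g).
move=> /(_ (fun x => x^-1)); apply.
  split; first by exists (fun x => x^-1) => x; rewrite invgK.
  by move=> x y; rewrite invgM comm.
have sq g : exists w, g = w * w \/ g = w * w * t.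
  elim/t_ind: g => [|g [w [->|->]]|g [w [->|->]]].
  - by exists 1; left; rewrite mulg1.
  - by exists w; right; rewrite comm_t.
  - by exists (w * t); left; rewrite (comm t) -!mulgA (mulgA w t t) {1}(comm w t) -!mulgA.
  - exists (w * t^-1); right; rewrite -[in RHS]mulgA mulgVK.
    by rewrite mulgA (comm t^-1 w).
  - by exists w; left; rewrite (comm t^-1) mulgK.
set cl := fun x : G => [set y | twisted_conj (fun x => x^-1) x y].
apply: (@sub_finite_set _ _ [set cl 1; cl t]); last exact: finite_set2.
have cl_sub x w : cl (w * w * x) `<=` cl x.
  move=> y [v <-]; exists (v * w^-1); rewrite invgM invgK; set u := v^-1.
  by rewrite {1}(comm w u) !mulgA -(mulgA (u * w)) (comm x w) !mulgA.
have clE x w : cl (w * w * x) = cl x.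
  apply/seteqP; split; first exact: cl_sub.
  by have := @cl_sub (w * w * x) w^-1; rewrite -!mulgA !mulKg.
move=> _ [x _ <-]; have [w [->|->]] := sq x; rewrite -/(cl _) ?clE; [left|right] => //.
by rewrite -[w * w]mulg1 clE.
Qed.

Section MachineGroup.
Variables (nq nr : nat) (rs : 'I_nr -> rule 'I_nq) (q0 h : 'I_nq) (n : nat).
Local Notation P := (machine_pres rs q0 h n).
Local Notation G := (presented_group P).
Local Notation T := (GT nq nr).

Definition mgen (a : gen nq nr) : G := pgen (@gidx nq nr) (machine_eqs rs q0 h n) a.
Local Notation t := (mgen T).

Lemma mgen_eq e : e \in machine_eqs rs q0 h n -> gprod mgen e.1 = gprod mgen e.2.
Proof. exact: pgen_eq. Qed.

Lemma mgen_ind (Q : G -> Prop) : Q 1 -> (forall a g, Q g -> Q (mgen a * g)) ->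
  (forall a g, Q g -> Q ((mgen a)^-1 * g)) -> forall g, Q g.
Proof. exact: (pres_ind (@gen_ofK nq nr)). Qed.

Lemma machine_not_R_infty : accepts rs h (q0, n) -> ~ R_infty G.
Proof.
move=> acc; apply: (@not_R_infty_cyclic _ t) => Q Q1 Qp Qn.
have one := machine_collapse mgen_eq acc.
apply: mgen_ind => // a g Qg; have [->|/eqP/one ->] := eqVneq a T;
  by [exact: Qp | exact: Qn | rewrite ?invg1 mul1g].
Qed.

Lemma machine_act (X : Type) (s s' : gen nq nr -> X -> X) :
  (forall a, cancel (s a) (s' a)) -> (forall a, cancel (s' a) (s a)) ->
  (forall e, e \in machine_eqs rs q0 h n -> forall x, foldr s x e.1 = foldr s x e.2) ->
  exists rho : G -> X -> X,
    [/\ forall x, rho 1 x = x, forall g h x, rho (g * h) x = rho g (rho h x)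
      & forall a x, rho (mgen a) x = s a x].
Proof. exact: (pres_act (@gidxK nq nr)). Qed.

Lemma machine_eqs_ind (Q : seq (gen nq nr) * seq (gen nq nr) -> Prop) :
  (forall e, e \in start_eq nr q0 n :: ugen_eqs rs h -> Q (lift_eq e)) ->
  (forall u e, e \in killer_eqs u -> Q e) ->
  (forall e, e \in top_eqs nq nr -> Q e) ->
  forall e, e \in machine_eqs rs q0 h n -> Q e.
Proof.
move=> Qu Qk Qt e; rewrite in_cons !mem_cat => /orP[/eqP->|/or3P[/mapP[e' e'u ->]||]].
- by apply: Qu; rewrite mem_head.
- by apply: Qu; rewrite in_cons e'u orbT.
- by move=> /flatten_mapP[u _]; exact: Qk.
- exact: Qt.
Qed.

Definition base_group : set G := [set g | forall B : set G, B 1 ->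
  (forall x y, B x -> B y -> B (x * y)) -> (forall x, B x -> B x^-1) ->
  (forall a, a <> T -> B (mgen a)) -> B g].
Local Notation A := base_group.

Lemma base1 : A 1.
Proof. by []. Qed.

Lemma baseM x y : A x -> A y -> A (x * y).
Proof. by move=> Ax Ay B B1 BM BV Bg; apply: (BM); [exact: Ax | exact: Ay]. Qed.

Lemma baseV x : A x -> A x^-1.
Proof. by move=> Ax B B1 BM BV Bg; apply: (BV); exact: Ax. Qed.

Lemma base_mgen a : a <> T -> A (mgen a).
Proof. by move=> aT B B1 BM BV Bg; exact: Bg. Qed.

Lemma mgen_top_eqN i : i < 8 -> let e := nth ([::], [::]) (top_eqs nq nr) i in
  gprod mgen e.1 = gprod mgen e.2.
Proof.
move=> i8 e; apply: (top_eq mgen_eq); exact: (@mem_nth _ _ (top_eqs nq nr)) i8.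
Qed.

Lemma mgen_killer_eqN u i : i < 6 -> let e := nth ([::], [::]) (killer_eqs u) i in
  gprod mgen e.1 = gprod mgen e.2.
Proof.
move=> i6 e; apply: (killer_eq mgen_eq (u := u)).
exact: (@mem_nth _ _ (killer_eqs u)) i6.
Qed.

Lemma mgen_invol a : a <> T -> a <> GD nq nr -> mgen a * mgen a = 1.
Proof.
case: a => [u|u||||] // _ _; first exact: (gu_invol mgen_eq).
- by have := @mgen_killer_eqN u 1%N isT; rewrite /= mulg1.
- by have := @mgen_top_eqN 0%N isT; rewrite /= mulg1.
- by have := @mgen_top_eqN 1%N isT; rewrite /= mulg1.
Qed.

Lemma tD : t * mgen (GD nq nr) = mgen (GD nq nr) * mgen (GD nq nr) * t.
Proof. by have := @mgen_top_eqN 5%N isT; rewrite /= !mulg1 mulgA. Qed.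

Lemma commute_t a : a <> T -> a <> GD nq nr -> commute t (mgen a).
Proof.
case: a => [u|u||||] // _ _.
- by have := @mgen_killer_eqN u 4%N isT; rewrite /= !mulg1.
- by have := @mgen_killer_eqN u 5%N isT; rewrite /= !mulg1.
- by have := @mgen_top_eqN 6%N isT; rewrite /= !mulg1.
- by have := @mgen_top_eqN 7%N isT; rewrite /= !mulg1.
Qed.

Lemma base_t x : A x -> A (t * x * t^-1).
Proof.
move=> Ax; pose B := [set x | A (t * x * t^-1)].
apply: (Ax B); rewrite /B /=.
- by rewrite mulg1 mulgV; exact: base1.
- by move=> y z /baseM/[apply]; rewrite !mulgA mulgVK.
- by move=> y /baseV; rewrite !invgM invgK mulgA.
- move=> a aT; have [->|/eqP aD] := eqVneq a (GD nq nr).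
    by rewrite tD mulgK; apply: baseM; exact: base_mgen.
  by rewrite commute_t // mulgK; exact: base_mgen.
Qed.

(** A factor [t] on the left either cancels one [t^-1] or moves to the right of [a] by [base_t]; an
    element of [A] is absorbed into [a] after conjugation by [t ^+ m]. *)
Lemma normal_form g : exists m m' a, A a /\ g = t ^- m * a * t ^+ m'.
Proof.
have A_tX k a : A a -> A (t ^+ k * a * t ^- k).
  move=> Aa; elim: k => [|k /base_t]; first by rewrite invg1 mulg1 mul1g.
  by rewrite expgS invgM !mulgA.
have push (b : G) m a m' : A b -> A a -> exists k k' a', A a' /\
    b * (t ^- m * a * t ^+ m') = t ^- k * a' * t ^+ k'.
  move=> Ab Aa; exists m, m', (t ^+ m * b * t ^- m * a).
  by split; [apply: baseM => //; exact: A_tX | rewrite !mulgA mulVg mul1g].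
elim/mgen_ind: g => [|c g|c g].
  by exists 0, 0, 1; split; [exact: base1 | rewrite invg1 !mulg1].
- move=> [m [m' [a [Aa ->]]]]; have [->|/eqP cT] := eqVneq c T; last first.
    by apply: push => //; exact: base_mgen.
  case: m => [|m]; last first.
    by exists m, m', a; rewrite expgSr invgM !mulgA mulgV mul1g.
  exists 0, m'.+1, (t * a * t^-1); split; first exact: base_t.
  by rewrite !invg1 !mul1g expgS !mulgA mulgVK.
- move=> [m [m' [a [Aa ->]]]]; have [->|/eqP cT] := eqVneq c T; last first.
    by apply: push => //; apply: baseV; exact: base_mgen.
  by exists m.+1, m', a; rewrite expgSr invgM !mulgA.
Qed.

(** The group acts on the integers by translations, with [t] adding 1 and the other generators
    acting trivially; [chi] is the displacement of 0. *)
Lemma exists_chi : exists chi : G -> int,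
  [/\ forall x y, chi (x * y) = (chi x + chi y)%R, chi t = 1%R
    & forall a, a <> T -> chi (mgen a) = 0%R].
Proof.
pose s (a : gen nq nr) (x : int) : int := if a is GT then (x + 1)%R else x.
pose s' (a : gen nq nr) (x : int) : int := if a is GT then (x - 1)%R else x.
have [||e|rho [rho1 rhoM rho_gen]] := @machine_act int s s'.
- by case=> // x; rewrite /s /s' addrK.
- by case=> // x; rewrite /s /s' subrK.
- have sU x u : foldr s x (map (@GU nq nr) u) = x by elim: u.
  elim/machine_eqs_ind => [{}e _ x|u {}e|{}e]; first by rewrite /= !sU.
    by rewrite /killer_eqs !in_cons in_nil orbF => /or4P[|||/or3P[]] /eqP->.
  by rewrite /top_eqs !in_cons in_nil orbF => /or4P[|||/or4P[|||/orP[]]] /eqP-> //=.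
have rhoE g x : rho g x = (rho g 0 + x)%R.
  elim/mgen_ind: g x => [|a g IH|a g IH] x.
  - by rewrite !rho1 add0r.
  - by rewrite !rhoM IH !rho_gen /s; case: a => // *; rewrite addrAC.
  - have inv_gen y : rho (mgen a)^-1 y = s' a y.
      have : s a (rho (mgen a)^-1 y) = y by rewrite -rho_gen -rhoM mulgV rho1.
      by rewrite /s /s'; case: (a) => // e; rewrite -[in RHS]e addrK.
    by rewrite !rhoM IH !inv_gen /s'; case: a {inv_gen} => // *; rewrite addrAC.
exists (fun g => rho g 0%R); split=> [x y||a aT].
- by rewrite rhoM rhoE.
- by rewrite rho_gen.
- by rewrite rho_gen; case: a aT.
Qed.

(** The kernel of [chi] comes from [normal_form]. A homomorphism to the integers kills involutions,
    and also [d], since [t * d = d * d * t]; hence it is determined by its value at [t]. *)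
Lemma machine_R_infty :
  ~ A (t^-1 * mgen (GD nq nr) * t) -> R_infty G.
Proof.
move=> nAD; have [chi [chiM chi_t chi_gen]] := exists_chi.
have chi1 : chi 1 = 0%R by have := chiM 1 1; rewrite mulg1 -[LHS]addr0 => /addrI.
have psiV (psi : G -> int) x : (forall x y, psi (x * y) = (psi x + psi y)%R) ->
    psi x^-1 = (- psi x)%R.
  move=> psiM; have psi1 : psi 1 = 0%R.
    by have := psiM 1 1; rewrite mulg1 -[LHS]addr0 => /addrI.
  by apply/eqP; rewrite -addr_eq0 -psiM mulVg psi1.
have chiX k : chi (t ^+ k) = k%:R%R.
  elim: k => [|k IHk]; first by rewrite expg0 chi1.
  by rewrite expgS chiM IHk chi_t -natr1 addrC.
have chi_A x : A x -> chi x = 0%R.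
  move=> Ax; apply: (Ax [set x | chi x = 0%R]) => //=.
  - by move=> y z; rewrite chiM => -> ->; rewrite addr0.
  - by move=> y; rewrite psiV // => ->; rewrite oppr0.
pose gs := [seq mgen a | a <- [seq gen_of i | i <- enum 'I_(ngen nq nr)] & a != T].
have gsP x : x \in gs <-> exists2 a, a <> T & x = mgen a.
  split=> [/mapP[a]|[a /eqP aT ->]].
    by rewrite mem_filter => /andP[/eqP aT _] ->; exists a.
  by apply: map_f; rewrite mem_filter aT -(gidxK a) map_f // mem_enum.
apply: (@R_infty_of_ascending G A gs t chi) => //.
- exact: baseM.
- exact: baseV.
- by move=> B B1 BM BV Bg x; apply=> // a aT; apply: Bg; apply/gsP; exists a.
- by move=> x /gsP[a aT ->]; exact: base_mgen.
- move=> x; split; last first.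
    move=> [k /chi_A]; rewrite !chiM psiV // chiX.
    by rewrite addrAC subrr add0r.
  have [m [m' [a [Aa ->]]]] := normal_form x.
  rewrite !chiM psiV // !chiX (chi_A _ Aa) addr0 addrC => /subr0_eq/eqP.
  rewrite eqr_nat => /eqP ->; exists m.
  by rewrite !mulgA mulgV mul1g mulgK.
- exact: base_t.
- by exists (mgen (GD nq nr)) => //; exact: base_mgen.
- move=> psi psiM; exists (psi t).
  have psi_gen a : a <> T -> psi (mgen a) = 0%R.
    move=> aT; have psi1 : psi 1 = 0%R.
      by have := psiM 1 1; rewrite mulg1 -[LHS]addr0 => /addrI.
    have [->|/eqP aD] := eqVneq a (GD nq nr).
      by have := congr1 psi tD; rewrite !psiM; lia.
    by have := congr1 psi (mgen_invol aT aD); rewrite psiM psi1; lia.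
  have genE a : psi (mgen a) = (psi t * chi (mgen a))%R.
    have [->|/eqP aT] := eqVneq a T; first by rewrite chi_t mulr1.
    by rewrite psi_gen // chi_gen // mulr0.
  elim/mgen_ind => [|a g IH|a g IH].
  + by rewrite chi1 mulr0 -(mulgV 1) psiM psiV // subrr.
  + by rewrite psiM chiM IH genE mulrDr.
  + by rewrite psiM chiM !psiV // IH genE mulrDr mulrN.
Qed.

End MachineGroup.

(** * A permutation model for a non-accepting machine *)

Import GRing.Theory Num.Theory.
Local Open Scope classical_set_scope.
Local Open Scope ring_scope.

(** * Permutations supported on lines *)

Section Lines.
Variable C : Type.
Implicit Types (l m : int -> C) (f : int -> int).

(** A line will be one side of a rule with its parameter ranging over all integers; its partial
    inverse is chosen classically. *)
Definition linv l c : option int :=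
  if pselect (exists u, c = l u) is left ex then Some (projT1 (cid ex)) else None.

Lemma linv_line l u : injective l -> linv l (l u) = Some u.
Proof.
move=> l_inj; rewrite /linv; case: pselect => [ex|[]]; last by exists u.
by congr Some; case: cid => v e /=; exact/esym/l_inj.
Qed.

Lemma linv_none l c : (forall u, c <> l u) -> linv l c = None.
Proof. by move=> cl; rewrite /linv; case: pselect => // ex; have [u /cl] := ex. Qed.

Variant line_spec l c : option int -> Prop :=
| OnLine u : c = l u -> line_spec l c (Some u)
| OffLine : (forall u, c <> l u) -> line_spec l c None.

Lemma linvP l c : line_spec l c (linv l c).
Proof.
rewrite /linv; case: pselect => [ex|nex].
  by apply: OnLine; exact: (projT2 (cid ex)).
by apply: OffLine => u cu; apply: nex; exists u.
Qed.

Definition lmap l f c := if linv l c is Some u then l (f u) else c.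

Definition lswap l m c :=
  if linv l c is Some u then m u else if linv m c is Some u then l u else c.

Lemma lmap_line l f u : injective l -> lmap l f (l u) = l (f u).
Proof. by move=> l_inj; rewrite /lmap linv_line. Qed.

Lemma lmap_off l f c : (forall u, c <> l u) -> lmap l f c = c.
Proof. by move=> cl; rewrite /lmap linv_none. Qed.

Lemma lmap_comp l f f' c : injective l -> lmap l f (lmap l f' c) = lmap l (f \o f') c.
Proof.
move=> l_inj; case: (linvP l c) => [u ->|cl]; first by rewrite !lmap_line.
by rewrite !lmap_off.
Qed.

Lemma lmap_id l c : lmap l id c = c.
Proof. by rewrite /lmap; case: linvP => // u ->. Qed.

Section Swap.
Variables (l m : int -> C).
Hypothesis (l_inj : injective l) (m_inj : injective m).
Hypothesis lm : forall u v, l u <> m v.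

Lemma lswap_l u : lswap l m (l u) = m u.
Proof. by rewrite /lswap linv_line. Qed.

Lemma lswap_m u : lswap l m (m u) = l u.
Proof.
by rewrite /lswap linv_none ?linv_line // => v /esym; exact: lm.
Qed.

Lemma lswap_off c : (forall u, c <> l u) -> (forall u, c <> m u) -> lswap l m c = c.
Proof. by move=> cl cm; rewrite /lswap !linv_none. Qed.

Lemma lswapK : involutive (lswap l m).
Proof.
move=> c; case: (linvP l c) => [u ->|cl]; first by rewrite lswap_l lswap_m.
case: (linvP m c) => [u ->|cm]; first by rewrite lswap_m lswap_l.
by rewrite !lswap_off.
Qed.

Lemma lswap_lmap f c : lswap l m (lmap l f (lswap l m c)) = lmap m f c.
Proof.
case: (linvP l c) => [u ->|cl].
  rewrite lswap_l (lmap_off _ (c := m u)) => [|v /esym]; last exact: lm.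
  by rewrite lswap_m lmap_off // => v; exact: lm.
case: (linvP m c) => [u ->|cm].
  by rewrite lswap_m lmap_line // lswap_l lmap_line.
by rewrite !(lswap_off, lmap_off).
Qed.
End Swap.
End Lines.

Section ConfigurationModel.
Variables (nq nr : nat) (rs : 'I_nr -> rule 'I_nq) (q0 h : 'I_nq) (n : nat).
Hypothesis rs_ok : machine_ok rs h.
Hypothesis not_acc : ~ accepts rs h (q0, n).

(** Integers replace natural numbers so that the shift is a permutation. *)
Definition conf : Type := ('I_nq * int)%type.

Definition shift (m : int) (c : conf) : conf := (c.1, c.2 + m).
Definition lsrc j (u : int) : conf := (src (rs j), (ra (rs j))%:Z + u * (rm (rs j))%:Z).
Definition ldst j (u : int) : conf := (dst (rs j), (rb (rs j))%:Z + u * (rn (rs j))%:Z).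

Definition acc_conf (c : conf) : bool :=
  `[< exists2 k : nat, c.2 = k%:Z & accepts rs h (c.1, k) >].

Lemma rm_gt0 j : (0 < rm (rs j))%N.
Proof. by have := ra_lt rs_ok j; lia. Qed.

Lemma rn_gt0 j : (0 < rn (rs j))%N.
Proof. by have := rb_lt rs_ok j; lia. Qed.

Lemma lsrc_inj j : injective (lsrc j).
Proof. by move=> u v [/addrI]; have := rm_gt0 j; nia. Qed.

Lemma ldst_inj j : injective (ldst j).
Proof. by move=> u v [/addrI]; have := rn_gt0 j; nia. Qed.

Lemma lsrc_ldst j u v : lsrc j u <> ldst j v.
Proof. by move=> [/(src_dst rs_ok)]. Qed.

(** Acceptance passes backwards along a rule by definition, and forwards because the machine is
    deterministic and the source is not a halting state. Hence [flipK] commutes with the action of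
    [UR j]. *)
Lemma acc_lsrc j u : acc_conf (lsrc j u) = acc_conf (ldst j u).
Proof.
have line_nat (a m k : nat) : (a < m)%N -> a%:Z + u * m%:Z = k%:Z ->
    exists2 v : nat, u = v%:Z & k = (a + v * m)%N.
  by move=> am e; exists (absz u); nia.
apply/asboolP/asboolP => -[k /= ek acc].
  have [v uv kv] := line_nat _ _ _ (ra_lt rs_ok j) ek.
  have st : rstep rs (src (rs j), k) (dst (rs j), rb (rs j) + v * rn (rs j))%N.
    by exists j; exists v; rewrite ?kv.
  exists (rb (rs j) + v * rn (rs j))%N; first by rewrite uv; lia.
  inversion acc as [[e1 e2]|c c' st' acc' e].
    by case: (src_halt rs_ok (i := j)).
  by rewrite (rstep_det rs_ok st st').
have [v uv kv] := line_nat _ _ _ (rb_lt rs_ok j) ek.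
exists (ra (rs j) + v * rm (rs j))%N; first by rewrite uv; lia.
by apply: accepts_step acc; exists j; exists v; rewrite ?kv.
Qed.

(** [flip c] negates the first bit above [c]; [flipK] negates the second bit
    wherever the first one is unset, and also above the accepting configurations.
    So [flipK] commutes with [flip c] exactly when [c] is accepting. *)
Definition cell : Type := (conf * bool * bool)%type.

Definition lift_cell (b : conf -> conf) (x : cell) : cell := (b x.1.1, x.1.2, x.2).
Definition flip (c : conf) (x : cell) : cell :=
  (x.1.1, (x.1.1 == c) (+) x.1.2, x.2).
Definition flipK (x : cell) : cell :=
  (x.1, (~~ x.1.2 || acc_conf x.1.1) (+) x.2).

(** The reflections for [UE] and [UF] compose to the shift by 1, and those for [UY j] and [UZ j] to
    the shift of the parameter on the source line of rule [j]. *)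
Definition uact (u : ugen nq nr) : cell -> cell :=
  match u with
  | UE => lift_cell (fun c => (c.1, 1 - c.2))
  | UF => lift_cell (fun c => (c.1, - c.2))
  | US => flip (q0, n%:Z)
  | UK => flipK
  | UT q => flip (q, 0)
  | UR j => lift_cell (lswap (lsrc j) (ldst j))
  | UY j => lift_cell (lmap (lsrc j) (fun u => 1 - u))
  | UZ j => lift_cell (lmap (lsrc j) (fun u => - u))
  end.

Lemma flip_invol c : involutive (flip c).
Proof. by move=> [[x a] b]; rewrite /flip /= addbA addbb. Qed.

Lemma uact_invol u : involutive (uact u).
Proof.
case: u => [||||q|j|j|j] /=; try exact: flip_invol.
- by move=> [[[q m] a] b]; rewrite /lift_cell /= opprB addrC subrK.
- by move=> [[[q m] a] b]; rewrite /lift_cell /= opprK.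
- by move=> [[c a] b]; rewrite /flipK /= addbA addbb.
- move=> [[c a] b]; rewrite /lift_cell /= lswapK //.
  + exact: lsrc_inj.
  + exact: ldst_inj.
  + exact: lsrc_ldst.
- move=> [[c a] b]; rewrite /lift_cell /= lmap_comp; last exact: lsrc_inj.
  rewrite (_ : _ \o _ = id) ?lmap_id //.
  by apply/funext => u; rewrite /= opprB addrC subrK.
- move=> [[c a] b]; rewrite /lift_cell /= lmap_comp; last exact: lsrc_inj.
  by rewrite (_ : _ \o _ = id) ?lmap_id //; apply/funext => u; rewrite /= opprK.
Qed.

Lemma shift0 c : shift 0 c = c.
Proof. by case: c => q m; rewrite /shift addr0. Qed.

Lemma shift_add m m' c : shift m (shift m' c) = shift (m + m') c.
Proof. by rewrite /shift /= -addrA [m' + m]addrC. Qed.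

Definition run (w : seq (ugen nq nr)) (x : cell) : cell := foldr uact x w.

Lemma run_cat v w x : run (v ++ w) x = run v (run w x).
Proof. exact: foldr_cat. Qed.

Lemma run_ux m x : run (ux nq nr m) x = lift_cell (shift m%:Z) x.
Proof.
case: x => [[c a] b]; rewrite /lift_cell /=; elim: m => [|m IHm]; first by rewrite shift0.
rewrite [LHS]/= -/(run _ _) IHm /lift_cell /shift /=.
by congr (_, _, _, _); lia.
Qed.

Lemma run_uxV m x : run (uxV nq nr m) x = lift_cell (shift (- m%:Z)) x.
Proof.
case: x => [[c a] b]; rewrite /lift_cell /=; elim: m => [|m IHm]; first by rewrite shift0.
rewrite [LHS]/= -/(run _ _) IHm /lift_cell /shift /=.
by congr (_, _, _, _); lia.
Qed.

Lemma run_uconf q m x : run (uconf nr q m) x = flip (q, m%:Z) x.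
Proof.
rewrite /uconf run_cat run_ux /= -/(run _ _) run_uxV.
case: x => [[[p k] a] b]; rewrite /lift_cell /flip /shift /= subrK.
by rewrite !xpair_eqE subr_eq0.
Qed.

Lemma lmapD l (m : int) c k : injective l ->
  (forall u, shift m (l u) = l (u + 1)) ->
  lmap l (fun u => u + k) (shift m c) = shift m (lmap l (fun u => u + k) c).
Proof.
move=> l_inj lm; case: (linvP l c) => [u ->|cl].
  by rewrite lm !lmap_line // lm addrAC.
rewrite !lmap_off // => u e; apply: (cl (u - 1)).
have -> : c = shift (- m) (shift m c) by rewrite shift_add addNr shift0.
by rewrite e (_ : l u = shift m (l (u - 1))) ?shift_add ?addNr ?shift0 // lm subrK.
Qed.

Lemma shift_lsrc j u : shift (rm (rs j))%:Z (lsrc j u) = lsrc j (u + 1).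
Proof. by rewrite /shift /lsrc /= mulrDl mul1r addrA. Qed.

Lemma shift_ldst j u : shift (rn (rs j))%:Z (ldst j u) = ldst j (u + 1).
Proof. by rewrite /shift /ldst /= mulrDl mul1r addrA. Qed.

Lemma run_z j x : run [:: UY _ j; UZ _ j] x =
  lift_cell (lmap (lsrc j) (fun u => u + 1)) x.
Proof.
case: x => [[c a] b]; rewrite /= /lift_cell /= lmap_comp; last exact: lsrc_inj.
by rewrite (_ : _ \o _ = fun u => u + 1) //; apply/funext => u /=; rewrite opprK addrC.
Qed.

Lemma run_zV j x : run [:: UZ _ j; UY _ j] x =
  lift_cell (lmap (lsrc j) (fun u => u + -1)) x.
Proof.
case: x => [[c a] b]; rewrite /= /lift_cell /= lmap_comp; last exact: lsrc_inj.
by rewrite (_ : _ \o _ = fun u => u + -1) //; apply/funext => u /=; rewrite opprB.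
Qed.

Lemma run_conj_z j w k x : (forall y, run w y = lift_cell (lmap (lsrc j) (fun u => u + k)) y) ->
  run (UR _ j :: w ++ [:: UR _ j]) x = lift_cell (lmap (ldst j) (fun u => u + k)) x.
Proof.
move=> wE; rewrite /= -/(run _ _) run_cat wE /= /lift_cell /= lswap_lmap //.
- exact: lsrc_inj.
- exact: ldst_inj.
- exact: lsrc_ldst.
Qed.

Lemma flip_lift b c x : injective b ->
  flip (b c) (lift_cell b x) = lift_cell b (flip c x).
Proof. by move=> b_inj; rewrite /flip /lift_cell /= inj_eq. Qed.

(** The underlying map of configurations is injective and fixes [l 0], the only place where the flip
    acts. *)
Lemma shift_lmap_fix l (m : int) x : injective l ->
  (forall u, shift m (l u) = l (u + 1)) ->
  let g := lift_cell (fun c => lmap l (fun u => u + -1) (shift m c)) in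
  g (flip (l 0) x) = flip (l 0) (g x).
Proof.
move=> l_inj lm g.
have inj1 : injective (fun c => lmap l (fun u => u + -1) (shift m c)).
  apply: (can_inj (g := fun c => shift (- m) (lmap l (fun u => u + 1) c))) => c.
  rewrite lmap_comp // (_ : _ \o _ = id) ?lmap_id ?shift_add ?addNr ?shift0 //.
  by apply/funext => u; rewrite /= addrNK.
by rewrite /g -(flip_lift _ _ inj1) lm lmap_line // addrK.
Qed.

Lemma run_eqs e : e \in start_eq nr q0 n :: ugen_eqs rs h ->
  forall x, run e.1 x = run e.2 x.
Proof.
rewrite /ugen_eqs !in_cons mem_cat => /or3P[/eqP-> x||/orP[|]].
- by rewrite [LHS]/= -/(run _ _) run_uconf flip_invol.
- have confE q m : acc_conf (q, m%:Z) -> forall x, run (UK _ _ :: uconf _ q m) x =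
      run (uconf _ q m ++ [:: UK nq nr]) x.
    move=> acc x; rewrite run_cat [LHS]/= -/(run _ _) !run_uconf /=.
    case: x => [[c a] b]; rewrite /flip /flipK /=; case: eqP => [->|//].
    by rewrite acc !orbT.
  move=> /eqP->; apply: confE; apply/asboolP; exists 1%N => //.
  exact: accepts_halt.
- by move=> /mapP[u _ ->] x; exact: uact_invol.
move=> /flatten_mapP[j _].
have zl := @lsrc_inj j; have zl' := @ldst_inj j.
have z1 := run_conj_z _ (run_z j); have z2 := run_conj_z _ (run_zV j).
rewrite /rule_eqs !in_cons in_nil orbF => /or4P[|||/or3P[]] /eqP-> x.
- rewrite !run_cat !run_z !run_ux /lift_cell /=.
  by rewrite lmapD //; exact: shift_lsrc.
- rewrite 2!run_cat [RHS]run_cat run_cat !run_uconf !run_zV !run_ux.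
  have -> : (src (rs j), (ra (rs j))%:Z) = lsrc j 0 by rewrite /lsrc mul0r addr0.
  exact: shift_lmap_fix (@shift_lsrc j).
- rewrite !run_cat !z1 !run_ux /lift_cell /=.
  by rewrite lmapD //; exact: shift_ldst.
- rewrite 2!run_cat [RHS]run_cat run_cat !run_uconf !z2 !run_ux.
  have -> : (dst (rs j), (rb (rs j))%:Z) = ldst j 0 by rewrite /ldst mul0r addr0.
  exact: shift_lmap_fix (@shift_ldst j).
- rewrite [LHS]/= -/(run _ _) run_cat !run_uconf.
  have -> : (src (rs j), (ra (rs j))%:Z) = lsrc j 0 by rewrite /lsrc mul0r addr0.
  have -> : (dst (rs j), (rb (rs j))%:Z) = ldst j 0 by rewrite /ldst mul0r addr0.
  have swK : involutive (lswap (lsrc j) (ldst j)) by apply: lswapK => //; exact: lsrc_ldst.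
  rewrite /= -(lswap_m zl' (@lsrc_ldst j) 0).
  rewrite flip_lift; last exact: inv_inj.
  by case: x => [[c a] b]; rewrite /lift_cell /flip /= !swK.
- case: x => [[c a] b]; rewrite /= /lift_cell /flipK /=.
  congr (_, _ (+) _); congr (_ || _).
  case: (linvP (lsrc j) c) => [u ->|cl]; first by rewrite lswap_l // acc_lsrc.
  case: (linvP (ldst j) c) => [u ->|cm].
    by rewrite lswap_m //; [rewrite acc_lsrc | exact: lsrc_ldst].
  by rewrite lswap_off.
Qed.

(** A nontrivial involution has a 2-cycle, which gives the gluing below something to match with the
    cycles of [bflip]. *)
Lemma uact_neq u : exists x, uact u x <> x.
Proof.
case: u => [||||q|j|j|j].
- by exists ((q0, 0), false, false); case.
- by exists ((q0, 1), false, false); case.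
- by exists ((q0, n%:Z), false, false); rewrite /= /flip /= eqxx; case.
- by exists ((q0, 0), false, false); case.
- by exists ((q, 0), false, false); rewrite /= /flip /= eqxx; case.
- exists (lsrc j 0, false, false); rewrite /= /lift_cell /= lswap_l; last exact: lsrc_inj.
  by move=> [/esym/(src_dst rs_ok)].
- exists (lsrc j 0, false, false); rewrite /= /lift_cell lmap_line; last exact: lsrc_inj.
  by move=> /(congr1 (fun y : cell => y.1.1))/lsrc_inj.
- exists (lsrc j 1, false, false); rewrite /= /lift_cell lmap_line; last exact: lsrc_inj.
  by move=> /(congr1 (fun y : cell => y.1.1))/lsrc_inj.
Qed.

Definition ksks := [:: UK nq nr; US nq nr; UK nq nr; US nq nr].

(** As the start configuration is not accepting, [flipK] acts above it for exactly one value of the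
    first bit, which [US] negates; so the commutator negates the second bit there. *)
Lemma run_ksks c a b : run ksks (c, a, b) = (c, a, (c == (q0, n%:Z)) (+) b).
Proof.
rewrite /= /flip /flipK /=; case: eqP => [->|_] /=; last by rewrite addbA addbb.
have -> : acc_conf (q0, n%:Z) = false.
  by apply/asboolP => -[k /= [<-]].
by rewrite !orbF; case: a; case: b.
Qed.

Lemma run_ksks_invol : involutive (run ksks).
Proof. by move=> [[c a] b]; rewrite !run_ksks addbA addbb. Qed.

Lemma run_ksks_neq : exists x, run ksks x <> x.
Proof. by exists ((q0, n%:Z), false, false); rewrite run_ksks eqxx; case. Qed.

End ConfigurationModel.

(** * The model of the whole group *)

Local Open Scope nat_scope.
Import GRing.Theory Num.Theory.
Local Open Scope classical_set_scope.

Section Coxeter.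
Variables (L : countType) (g : L -> L).
Hypothesis (gK : involutive g) (g_neq : exists x, g x <> x).

(** Copying [M] along [nat] gives a nontrivial involution infinitely many 2-cycles, even if it has
    only finitely many on [M]; the second summand carries those of [bflip]. *)
Definition glue (M : Type) : Type := (M * nat + nat * bool)%type.

Definition glift (M : Type) (f : M -> M) (x : glue M) : glue M :=
  match x with inl (y, i) => inl (f y, i) | inr k => inr k end.

Definition bflip (M : Type) (x : glue M) : glue M :=
  match x with inl y => inl y | inr (k, b) => inr (k, ~~ b) end.

(** Choosing one point in each 2-cycle of [glift g] matches the 2-cycles of
    [glift g] with those of [bflip]; [c] swaps the chosen points of matching
    cycles, so that [bflip], [c] and [glift g] act on each pair of cycles as the
    transpositions (12), (23), (34). *)
Lemma coxeter_completion : exists c : glue L -> glue L,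
  [/\ involutive c,
      forall x, bflip (c (bflip (c (bflip (c x))))) = x
    & forall x, c (glift g (c (glift g (c (glift g x))))) = x].
Proof.
(* In each 2-cycle the chosen point is the one with the smaller code. *)
pose tb (x : L * nat) := pickle x.1 < pickle (g x.1).
pose T : set (L * nat) := [set x | tb x].
have [l0 l0_lt] : exists l, pickle l < pickle (g l).
  have [x gx] := g_neq; case: (ltngtP (pickle x) (pickle (g x))) => [||e].
  - by exists x.
  - by exists (g x); rewrite gK.
  - by case: gx; apply: (pcan_inj pickleK).
have T_card : (T #= [set: nat])%card.
  apply: eq_card_nat; first exact: countableP.
  move=> /(finite_image snd) fin; apply: infinite_nat.
  by apply: sub_finite_set fin => k _; exists (l0, k).
have [f [_ f_inj f_surj]] := card_set_bijP T_card.
have /choice[f' f'P] k : exists x, tb x /\ f x = k.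
  by have [x Tx fx] := f_surj k I; exists x.
have f'T k : tb (f' k) by case: (f'P k).
have f'K k : f (f' k) = k by case: (f'P k).
have fK x : tb x -> f' (f x) = x.
  by move=> Tx; apply: f_inj; rewrite ?inE ?f'K //; exact: f'T.
pose c (x : glue L) : glue L :=
  match x with
  | inl y => if tb y then inr (f y, false) else inl y
  | inr (k, false) => inl (f' k)
  | inr (k, true) => inr (k, true)
  end.
have cT y : tb y -> c (inl y) = inr (f y, false) by rewrite /c => ->.
have cN y : ~~ tb y -> c (inl y) = inl y by rewrite /c => /negbTE ->.
have cF k : c (inr (k, false)) = inl (f' k) by [].
have cTr k : c (inr (k, true)) = inr (k, true) by [].
have bL y : bflip (inl y) = inl y :> glue L by [].
have bR k b : bflip (inr (k, b)) = inr (k, ~~ b) :> glue L by [].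
have gL y i : glift g (inl (y, i)) = inl (g y, i) by [].
have gR x : glift g (inr x) = inr x by [].
have stepE := (cF, cTr, bL, fun k => bR k true, fun k => bR k false).
have tbg l i : tb (l, i) -> ~~ tb (g l, i) by rewrite /tb /= gK; lia.
have gT y : tb y -> c (inl (g y.1, y.2)) = inl (g y.1, y.2).
  by case: y => l i /tbg /cN.
exists c; split=> [[y|[k []]]|[y|[k []]]|[[l i]|[k []]]] //.
- by case: (boolP (tb y)) => Ty; [rewrite cT // cF fK | rewrite !cN].
- by rewrite cF cT ?f'T // f'K.
- case: (boolP (tb y)) => Ty; last by rewrite !(cN, bL).
  by rewrite cT // !stepE fK.
- by rewrite !stepE cT ?f'T // f'K !stepE.
- by rewrite !stepE cT ?f'T // f'K !stepE.
- case: (boolP (tb (l, i))) => Ty.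
    by rewrite gL (gT (l, i)) // gL gK cT // gR cF fK.
  case: (boolP (tb (g l, i))) => Tg.
    by rewrite gL cT // gR cF fK // gL gK cN.
  have gl : g l = l by apply: (pcan_inj pickleK); move: Ty Tg; rewrite /tb /= gK; lia.
  by rewrite !(gL, gl, cN).
- rewrite gR cF; move: (f'K k) (f'T k); case: (f' k) => l i fk Ty.
  by rewrite gL (gT (l, i)) // gL gK cT // fk.
Qed.

End Coxeter.

Local Open Scope ring_scope.

Section MachineModel.
Variables (nq nr : nat) (rs : 'I_nr -> rule 'I_nq) (q0 h : 'I_nq) (n : nat).
Hypothesis rs_ok : machine_ok rs h.
Hypothesis not_acc : ~ accepts rs h (q0, n).
Local Notation G := (presented_group (machine_pres rs q0 h n)).
Local Notation mgen := (@mgen nq nr rs q0 h n).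
Local Notation t := (mgen (GT nq nr)).
Local Notation d := (mgen (GD nq nr)).
Local Notation M := (cell nq).
Local Notation ua := (uact rs q0 h n).

Let space := (glue M * rat)%type.

(** [GD] will translate a rational coordinate by the charge. Since [bflip] changes its sign, [GB]
    inverts [GD], and doubling the coordinate by [GT] turns [GD] into its square. *)
Let charge (x : glue M) : int :=
  match x with inr (0%N, b) => (-1) ^+ b | _ => 0 end.

Let charge_flip x : charge (bflip x) = - charge x.
Proof. by case: x => [y|[[|k] []]] //=; rewrite ?oppr0. Qed.

Lemma machine_model : exists rho : G -> space -> space,
  [/\ forall x, rho 1%g x = x, forall g g' x, rho (g * g')%g x = rho g (rho g' x),
      forall x, rho t x = (x.1, 2 * x.2), forall x, rho d x = (x.1, x.2 + (charge x.1)%:~R)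
    & forall a x, a <> GT nq nr -> a <> GD nq nr -> (rho (mgen a) x).2 = x.2].
Proof.
have /choice[cu cuP] u := @coxeter_completion ('I_nq * int * bool * bool)%type
  (ua u) (uact_invol q0 n rs_ok u) (uact_neq q0 n rs_ok u).
have [cw [cwK cw1 cw2]] := @coxeter_completion ('I_nq * int * bool * bool)%type
  (run rs q0 h n (ksks nq nr)) (run_ksks_invol not_acc) (run_ksks_neq not_acc).
pose s2 a : glue M -> glue M :=
  match a with
  | GU u => glift (ua u) | GC u => cu u | GB => @bflip _ | GW => cw
  | GD | GT => id
  end.
pose s a (x : space) : space :=
  (s2 a x.1, match a with
             | GD => x.2 + (charge x.1)%:~R | GT => 2 * x.2 | _ => x.2 end).
pose s' a (x : space) : space :=
  (s2 a x.1, match a with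
             | GD => x.2 - (charge x.1)%:~R | GT => 2^-1 * x.2 | _ => x.2 end).
have gliftK (f : M -> M) : involutive f -> involutive (glift f).
  by move=> fK [[y i]|k] //=; rewrite fK.
have s2K a : involutive (s2 a).
  case: a => [u|u||||] //=.
  - by apply: gliftK; exact: uact_invol.
  - by case: (cuP u).
  - by case=> [y|[k b]] //=; rewrite negbK.
have sK a : cancel (s a) (s' a).
  case=> x r; rewrite /s /s' /= s2K; congr (_, _); case: a => //=.
  - by rewrite addrK.
  - by rewrite mulKf.
have s'K a : cancel (s' a) (s a).
  case=> x r; rewrite /s /s' /= s2K; congr (_, _); case: a => //=.
  - by rewrite subrK.
  - by rewrite mulVKf.
have runE w x r : foldr s (x, r) (map (@GU nq nr) w) = (glift (run rs q0 h n w) x, r).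
  elim: w => [|u w IHw] /=; first by case: x => [[]|].
  by rewrite IHw /s /=; case: x {IHw} => [[y i]|k].
have [e|rho [rho1 rhoM rho_gen]] := @machine_act _ _ rs q0 h n space s s' sK s'K.
  elim/machine_eqs_ind => [{}e e_u [x r]|u {}e|{}e].
  - rewrite /= !runE; case: x => [[y i]|k] //=.
    by rewrite (run_eqs rs_ok e_u).
  - have [cK c1 c2] := cuP u.
    rewrite /killer_eqs !in_cons in_nil orbF => /or4P[|||/or3P[]] /eqP-> [x r];
      rewrite /= /s /= ?c1 ?c2 ?cK //.
    by case: x => [[y i]|[k b]].
  rewrite /top_eqs !in_cons in_nil orbF.
  move=> /or4P[|||/or4P[|||/orP[]]] /eqP-> [x r].
  - by rewrite /= /s /=; case: x => [y|[k b]] //=; rewrite negbK.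
  - by rewrite /= /s /= cwK.
  - by rewrite /= /s /= cw1.
  - have cube w : (forall y r', foldr s (y, r') w =
        (glift (run rs q0 h n (ksks nq nr)) y, r')) ->
        foldr s (x, r) (GW nq nr :: w ++ GW nq nr :: w ++ GW nq nr :: w) = (x, r).
      move=> wE; rewrite /= foldr_cat /= foldr_cat /=.
      by rewrite !wE /s /= cw2.
    by apply: cube => y r'; exact: (runE (ksks nq nr)).
  - rewrite /= /s /= charge_flip rmorphN /= addrK.
    by case: x => [y|[k b]] //=; rewrite negbK.
  - by rewrite /= /s /= mulrDr -addrA -[X in _ = (_, _ + X)]mulr2n -[X in _ = (_, _ + X)]mulr_natl.
  - by [].
  - by [].
exists rho; split=> // a x aT aD.
by rewrite rho_gen /s /=; case: a aT aD.
Qed.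

(** Every element of the base group preserves integrality of the rational coordinate, whereas
    [t^-1 * d * t] translates by half the charge. *)
Lemma not_accepting_R_infty : R_infty G.
Proof.
have [rho [rho1 rhoM rho_t rho_d rho_gen]] := machine_model.
pose intq (r : rat) := exists z : int, r = z%:~R.
apply: machine_R_infty; set x := (_ * _)%g => Ax.
have intD r (z : int) : intq (r + z%:~R) <-> intq r.
  split=> -[y e]; last by exists (y + z); rewrite e rmorphD.
  by exists (y - z); rewrite rmorphB /= -e addrK.
have int_A : forall y, intq (rho x y).2 <-> intq y.2.
  apply: (Ax [set g | forall y, intq (rho g y).2 <-> intq y.2]) => /=.
  - by move=> y; rewrite rho1.
  - by move=> g g' Bg Bg' y; rewrite rhoM Bg Bg'.
  - by move=> g Bg y; rewrite -Bg -rhoM mulgV rho1.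
  - move=> a aT y; have [->|/eqP aD] := eqVneq a (GD nq nr); first by rewrite rho_d /= intD.
    by rewrite rho_gen.
(* At this point of charge 1, [t^-1 * d * t] would send the coordinate 0 to an integer whose double
   is 1. *)
pose y : space := (inr (0%N, false), 0).
have [z zE] : intq (rho x y).2 by apply/int_A; exists 0.
have e : rho t (rho x y) = rho d (rho t y).
  by rewrite -!rhoM /x -!mulgA mulVKg.
move: (congr1 snd e); rewrite rho_d !rho_t [LHS]/= zE /= mulr0 add0r => /eqP.
rewrite -[2]/(2%:~R) -rmorphM eqr_int /=; lia.
Qed.

End MachineModel.

(** * The diagonal argument *)

Local Open Scope nat_scope.

(** The recursion step of [CodeSeq.code], with doubling written as multiplication. *)
Definition code_step a m := 2 ^ a * (2 * m).+1.

Lemma computable1_code_step a : computable1 (code_step a).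
Proof.
apply: (computable1_comp (computable1_mull (2 ^ a))).
exact: (computable1_comp computable1_succ (computable1_mull 2)).
Qed.

Lemma computable2_code_step : computable2 code_step.
Proof.
apply: (computable_comp2 (computable2_expM 2) (computable_proj ord0)).
have step := computable1_comp computable1_succ (computable1_mull 2).
exact: (computable_comp1 step (computable_proj ord_max)).
Qed.

Lemma code_consE a s : CodeSeq.code (a :: s) = code_step a (CodeSeq.code s).
Proof. by rewrite /code_step mul2n. Qed.

Lemma code_flatten_nseq a b k s :
  CodeSeq.code (flatten (nseq k [:: a; b]) ++ s) =
  iter k (fun m => code_step a (code_step b m)) (CodeSeq.code s).
Proof. by elim: k => //= k <-; rewrite /code_step !mul2n. Qed.

(** The code of the relator [US (UE UF)^n (UT 0) (UF UE)^n]: the generators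
    [UE, UF, US] and [UT 0] have indices 0, 1, 2 and 4. *)
Definition start_code n :=
  code_step 4 (iter n (fun m => code_step 0 (code_step 2 m))
    (code_step 8 (iter n (fun m => code_step 2 (code_step 0 m)) 0))).

Lemma computable1_start_code : computable1 start_code.
Proof.
have step2 a b : computable1 (fun m => code_step a (code_step b m)).
  exact: computable1_comp (computable1_code_step a) (computable1_code_step b).
apply: (computable1_comp (computable1_code_step 4)).
apply: (computable_comp2 (computable2_iter (step2 0 2)) (computable_proj ord0)).
apply: (computable_comp1 (computable1_code_step 8)).
exact: (computable1_iterl 0 (step2 2 0)).
Qed.

Lemma encode_start_eq nq nr n :
  encode_word (eq_relator (@gidx nq.+1 nr) (lift_eq (start_eq nr ord0 n))) = start_code n.
Proof.
have encE (w : seq (ugen nq.+1 nr)) :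
    map (@encode_letter _) (pos_word (@gidx nq.+1 nr) (map (@GU _ _) w)) =
    map (fun u => encode_letter (gidx (GU u), false)) w.
  by rewrite /pos_word -!map_comp.
(* A positive letter of index [i] has code [2 * i], whence 0, 2, 4 and 8. *)
have wE : map (@encode_letter _) (eq_relator (@gidx nq.+1 nr) (lift_eq (start_eq nr ord0 n))) =
    4 :: flatten (nseq n [:: 0; 2]) ++ 8 :: flatten (nseq n [:: 2; 0]).
  rewrite /eq_relator cats0 encE /= /uconf map_cat /= !map_flatten !map_nseq.
  by [].
rewrite /encode_word wE code_consE code_flatten_nseq code_consE.
by rewrite -[flatten (nseq n [:: 2; 0])]cats0 code_flatten_nseq.
Qed.

Definition goedel2 k m := pr 0 ^ k * pr 1 ^ m.

Definition diagonal_code k m := code_step k (code_step (start_code (goedel2 k m)) m).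

Lemma computable2_diagonal_code : computable2 diagonal_code.
Proof.
have p1 := computable_proj (@ord0 1); have p2 := computable_proj (@ord_max 1).
apply: (computable_comp2 computable2_code_step) => //.
apply: (computable_comp2 computable2_code_step) => //.
apply: (computable_comp1 computable1_start_code).
apply: (computable_comp2 (computable2_expM (pr 0))) => //.
have := computable_comp2 (computable2_expM (pr 1)) p2 (computable_const 2 1).
set F := fun _ => _; set F' := fun _ => _; suff -> : F = F' by [].
by apply/funext => v; rewrite /F /F' muln1.
Qed.

Lemma encode_machine_pres nq nr (rs : 'I_nr -> rule 'I_nq.+1) h n :
  encode_presentation (machine_pres rs ord0 h n) =
  code_step (ngen nq.+1 nr) (code_step (start_code n) (CodeSeq.code
    [seq encode_word (eq_relator (@gidx nq.+1 nr) e) | e <- fixed_eqs rs h])).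
Proof.
pose R := eq_relator (@gidx nq.+1 nr).
rewrite /encode_presentation code_consE -[relators _]/(R _ :: map R (fixed_eqs rs h)).
by rewrite map_cons code_consE -map_comp /R encode_start_eq.
Qed.

Theorem corollary4p1p11 :
  ~ algorithmically_decidable encode_presentation
      (fun P : presentation => R_infty (presented_group P)).
Proof.
move=> [f fP].
have [g gP] := computable2_self_halting f computable2_diagonal_code.
have [nq [nr [rs [h [rs_ok accP]]]]] := machine_of_rec_fun g.
pose k := ngen nq.+1 nr.
pose m := CodeSeq.code
  [seq encode_word (eq_relator (@gidx nq.+1 nr) e) | e <- fixed_eqs rs h].
(* The input is built from the number of generators and the code of the fixed relators of this very
   presentation, so its code is [diagonal_code k m]. *)
have := fP (machine_pres rs ord0 h (goedel2 k m)).
rewrite encode_machine_pres -/m -/k -/(diagonal_code k m) => -[yes no].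
have [halts diverges] := gP k m.
have acc_halts := accP k m.
(* If the group had the property, [f] would answer 1, the machine would accept, and the group would
   collapse to a cyclic one. *)
have nR : ~ R_infty (presented_group (machine_pres rs ord0 h (goedel2 k m))).
  by move=> /[dup] /yes/halts/acc_halts/machine_not_R_infty.
(* So [f] answers 0 and the machine does not accept, which gives the group the property after
   all. *)
apply: nR; apply: not_accepting_R_infty => // /acc_halts.
apply: diverges; apply: no => R.
by case: (machine_not_R_infty _ R); apply/acc_halts/halts/yes.
Qed.
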